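(* Let $\theta\in[0,1)$ and $\varphi:z\in\mathbb{D}\mapsto e^{2i\pi\theta}z$. For any $r\in[0,1]$ let $\Gamma_r$ be the circle of center $0$ and radius $r$, and let $\xi_r$ be the quotient map $$C(\mathbb{D})\rtimes_\varphi\mathbb{Z}\overset{\xi_r}{\longrightarrow}\begin{cases}C(\Gamma_r)\rtimes_\varphi\mathbb{Z}=\mathcal{A}_\theta&\text{if }r>0,\\ C(\Gamma_0)\rtimes_\varphi\mathbb{Z}=C(\mathbb{T})&\text{if }r=0.\end{cases}$$ Then $\pi$ is an irreducible representation of $C(\mathbb{D})\rtimes_\varphi\mathbb{Z}$ if and only if either of the following holds: (a) there exist $r\in(0,1]$ and an irreducible representation $\rho$ of $\mathcal{A}_\theta$ such that $\pi=\rho\circ\xi_r$; (b) there exists $\omega\in\mathbb{T}$ such that $\pi=\nu_\omega\circ\xi_0$, where $\nu_\omega(f)=f(\omega)$ for all $f\in C(\mathbb{T})$ (up to unitary equivalence). Consequently, two such representations $\rho\circ\xi_r$ and $\rho'\circ\xi_{r'}$ are unitarily equivalent if and only if $r=r'$ and $\rho$ and $\rho'$ are unitarily equivalent representations of $C(\Gamma_r)\rtimes_\varphi\mathbb{Z}$.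
   Context: $\mathbb{D}=\{z\in\mathbb{C}:|z|\le 1\}$, $\mathbb{T}=\{|z|=1\}$. For a homeomorphism $\varphi$ of a compact space $X$, $C(X)\rtimes_\varphi\mathbb{Z}$ is the universal C*-algebra generated by $C(X)$ and a unitary $U_\varphi$ with $U_\varphi^*fU_\varphi=f\circ\varphi$ for all $f\in C(X)$. $\mathcal{A}_\theta$ is the universal C*-algebra generated by two unitaries $U,V$ with $VU=e^{2i\pi\theta}UV$. For a $\varphi$-invariant closed set $\Gamma_r$, $\xi_r$ is induced by restriction $f\mapsto f|_{\Gamma_r}$ and sends canonical unitary to canonical unitary. For $r>0$, $C(\Gamma_r)\rtimes_\varphi\mathbb{Z}$ is identified with $\mathcal{A}_\theta$ by sending the canonical unitary to $U$ and the function $z$ to $rV$; for $r=0$ the canonical unitary is identified with the function $z\mapsto z$ in $C(\mathbb{T})$. *)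

(* Defs.v *)
From HB Require Import structures.
From mathcomp Require Import all_boot all_order all_algebra.
From mathcomp Require Import all_classical all_reals all_analysis.
From mathcomp Require Import complex.

Set Implicit Arguments.
Unset Strict Implicit.
Unset Printing Implicit Defensive.

Import Order.TTheory GRing.Theory Num.Theory.
Import numFieldNormedType.Exports.

Local Open Scope classical_set_scope.
Local Open Scope complex_scope.
Local Open Scope ring_scope.

(* The library equips only the regular algebra [R[i]^o] with a topology. *)
HB.instance Definition _ (R : realType) := PseudoPointedMetric.copy R[i] R[i]^o.
HB.instance Definition _ (R : realType) := NormedModule.copy R[i] R[i]^o.

Section ComplexNumbers.
Variable R : realType.
Implicit Types z w : R[i].

Lemma normC_Re_le z : `|complex.Re z|%:C <= `|z|.
Proof.
case: z => a b; rewrite normc_def lecR /= -sqrtr_sqr ler_wsqrtr //.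
by rewrite lerDl sqr_ge0.
Qed.

Lemma normC_Im_le z : `|complex.Im z|%:C <= `|z|.
Proof.
case: z => a b; rewrite normc_def lecR /= -sqrtr_sqr ler_wsqrtr //.
by rewrite lerDr sqr_ge0.
Qed.

Lemma normC_le_ReIm z :
  `|z| <= (`|complex.Re z| + `|complex.Im z|)%:C.
Proof.
case: z => a b /=.
have -> : a +i* b = a%:C + 'i * b%:C by simpc.
rewrite (le_trans (ler_normD _ _)) // normrM.
by rewrite !normc_def /= !(expr0n, addr0, add0r, expr1n) /= sqrtr1 mul1r
  !sqrtr_sqr -rmorphD.
Qed.

Lemma complex_complete (F : set_system R[i]) :
  ProperFilter F -> cauchy F -> cvg F.
Proof.
move=> FF /cauchy_ballP Fc.
have proj_cvg (p : R[i] -> R) :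
    (forall z w, p (z - w) = p z - p w) ->
    (forall z, `|p z|%:C <= `|z|) -> cvg (p @ F).
  move=> pB ple; apply: R_complete; apply/cauchy_ballP => e e0.
  have e0' : 0 < e%:C by rewrite ltcR.
  have := Fc _ e0'; rewrite !near_simpl.
  have -> : p @ F = fmap p F by [].
  move=> [[A B] /= [FA FB] AB].
  exists (p @` A, p @` B) => /=.
    by split; [apply: filterS FA | apply: filterS FB] => z Az; exists z.
  move=> [_ _] /= [[z Az <-] [w Bw <-]].
  have := AB (z, w) (conj Az Bw); rewrite /ball /= => zw.
  by rewrite -pB -ltcR (le_lt_trans (ple _)).
have /cvg_ex[a Fa] : cvg (@complex.Re R @ F).
  by apply: proj_cvg => [[? ?] [? ?]|] //; exact: normC_Re_le.
have /cvg_ex[b Fb] : cvg (@complex.Im R @ F).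
  by apply: proj_cvg => [[? ?] [? ?]|] //; exact: normC_Im_le.
apply/cvg_ex; exists (a +i* b : R[i]); apply/cvgrPdist_lt => e e0.
have eE : e = (complex.Re e)%:C.
  by move: e0; case: e => x y /=; rewrite ltcE /= => /andP[/eqP y0 _]; rewrite y0.
have e'0 : 0 < complex.Re e / 2 by rewrite divr_gt0 // -ltcR -eE.
have /cvgrPdist_lt/(_ _ e'0) Fa' := Fa.
have /cvgrPdist_lt/(_ _ e'0) Fb' := Fb.
near=> z.
have za : `|a - complex.Re z| < complex.Re e / 2 by near: z; exact: Fa'.
have zb : `|b - complex.Im z| < complex.Re e / 2 by near: z; exact: Fb'.
apply: (le_lt_trans (normC_le_ReIm _)).
rewrite eE ltcR.
have -> : complex.Re (a +i* b - z) = a - complex.Re z by case: (z).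
have -> : complex.Im (a +i* b - z) = b - complex.Im z by case: (z).
by rewrite [ltRHS](splitr (complex.Re e)) ltrD.
Unshelve. all: by end_near. Qed.

HB.instance Definition _ := Uniform_isComplete.Build R[i] complex_complete.

Lemma conjC_continuous : continuous (fun z : R[i] => z^*).
Proof.
move=> z.
apply/(@cvgrPdist_lt _ R[i] _ _ (nbhs_filter (z : R[i]))) => e e0.
near=> w; rewrite -rmorphB norm_conjC.
suff: ball (z : R[i]) e w by [].
by near: w; exact: nbhsx_ballx.
Unshelve. all: by end_near. Qed.

(* [expi t] is e^(i t). *)
Definition expi (t : R) : R[i] := cos t +i* sin t.

Lemma norm_expi t : `|expi t| = 1.
Proof. by rewrite normc_def /= cos2Dsin2 sqrtr1. Qed.

Lemma expiNK t : expi (- t) * expi t = 1.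
Proof.
rewrite /expi cosN sinN; simpc.
by rewrite -!expr2 cos2Dsin2 [sin t * _]mulrC addrN.
Qed.

End ComplexNumbers.

(* Unital C*-algebras. The library's ring structures cannot be joined with its
   normed modules (Hierarchy Builder would need [numDomainType] to inherit from
   the join), so the product is declared on top of the module structure.
   [starAlgType] is the part of the structure that *-homomorphisms preserve. *)

HB.mixin Record Lmodule_isStarAlgebra (R : realType) A
    of GRing.Lmodule R[i] A := {
  amul : A -> A -> A;
  aone : A;
  star : A -> A;
  amulA : associative amul;
  amul1l : left_id aone amul;
  amul1r : right_id aone amul;
  amul_linearl : forall (a : R[i]) (x y z : A),
    amul (a *: x + y) z = a *: amul x z + amul y z;
  amul_linearr : forall (a : R[i]) (x y z : A),
    amul x (a *: y + z) = a *: amul x y + amul x z;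
  starK : involutive star;
  star_semilinear : forall (a : R[i]) (x y : A),
    star (a *: x + y) = a^* *: star x + star y;
  starM : forall x y : A, star (amul x y) = amul (star y) (star x)
}.

#[short(type="starAlgType")]
HB.structure Definition StarAlgebra (R : realType) :=
  {A of GRing.Lmodule R[i] A & Lmodule_isStarAlgebra R A}.

Notation "x *a y" := (amul x y) (at level 40, left associativity) : ring_scope.

HB.mixin Record StarAlgebra_isCStar (R : realType) A
    of StarAlgebra R A & CompleteNormedModule R[i] A := {
  cstar_normM : forall x y : A, `|x *a y| <= `|x| * `|y|;
  cstar_norm : forall x : A, `|star x *a x| = `|x| ^+ 2
}.

#[short(type="cstarType")]
HB.structure Definition CStar (R : realType) :=
  {A of StarAlgebra R A & CompleteNormedModule R[i] A
      & StarAlgebra_isCStar R A}.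

Section StarAlgebras.
Variable R : realType.

Definition star_hom (A B : starAlgType R) (f : A -> B) : Prop :=
  [/\ linear f, f aone = aone, {morph f : x y / x *a y}
    & {morph f : x / star x}].

Definition star_iso (A B : starAlgType R) (f : A -> B) : Prop :=
  star_hom f /\ bijective f.

Definition unitary (A : starAlgType R) (u : A) : Prop :=
  star u *a u = aone /\ u *a star u = aone.

Definition star_subalgebra (A : starAlgType R) (S : set A) : Prop :=
  [/\ S aone,
      forall (a : R[i]) x y, S x -> S y -> S (a *: x + y),
      forall x y, S x -> S y -> S (x *a y)
    & forall x, S x -> S (star x)].

(* [G] generates [A] as a C*-algebra. *)
Definition generates (A : cstarType R) (G : set A) : Prop :=
  forall S : set A, closed S -> star_subalgebra S -> G `<=` S -> S = setT.

End StarAlgebras.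

Definition CX (R : realType) (X : topologicalType) :=
  continuousType X R[i].

HB.instance Definition _ (R : realType) (X : topologicalType) :=
  Choice.on (CX R X).

Section ContinuousFunctions.
Variables (R : realType) (X : topologicalType).
Local Notation C := R[i].
Local Notation CX := (CX R X).
Implicit Types f g h : CX.

Definition mkCX (f : X -> C) (cf : continuous f) : CX := mkcts cf.

Lemma CXP f g : (forall x, f x = g x) -> f = g.
Proof. by move=> fg; apply/continuousEP. Qed.

Fact CX_add_subproof f g : continuous (fun x => f x + g x : C).
Proof. move=> x; exact: (@continuousD _ C _ f g x (cts_fun x) (cts_fun x)). Qed.
Fact CX_opp_subproof f : continuous (fun x => - f x : C).
Proof. move=> x; exact: (@continuousN _ C _ f x (cts_fun x)). Qed.
Fact CX_mul_subproof f g : continuous (fun x => f x * g x : C).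
Proof. move=> x; exact: (@continuousM R[i] X f g x (cts_fun x) (cts_fun x)). Qed.
Fact CX_scale_subproof (a : R[i]) f : continuous (fun x => a * f x : C).
Proof.
move=> x; apply: (@continuousM R[i] X (fun=> a) f x _ (cts_fun x)).
exact: cst_continuous.
Qed.
Fact CX_cst_subproof (a : R[i]) : continuous (fun _ : X => a : C).
Proof. exact: cst_continuous. Qed.
Fact CX_star_subproof f : continuous (fun x => (f x)^*).
Proof.
move=> x; apply: (@continuous_comp _ _ _ f (fun z : C => z^*)).
  exact: cts_fun.
exact: conjC_continuous.
Qed.

Definition CX_add f g := mkCX (@CX_add_subproof f g).
Definition CX_opp f := mkCX (@CX_opp_subproof f).
Definition CX_mul f g := mkCX (@CX_mul_subproof f g).
Definition CX_scale a f := mkCX (@CX_scale_subproof a f).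
Definition CX_cst a := mkCX (@CX_cst_subproof a).
Definition CX_star f := mkCX (@CX_star_subproof f).

Fact CX_addA : associative CX_add.
Proof. by move=> f g h; apply: CXP => x; exact: addrA. Qed.
Fact CX_addC : commutative CX_add.
Proof. by move=> f g; apply: CXP => x; exact: addrC. Qed.
Fact CX_add0 : left_id (CX_cst 0) CX_add.
Proof. by move=> f; apply: CXP => x; exact: add0r. Qed.
Fact CX_addN : left_inverse (CX_cst 0) CX_opp CX_add.
Proof. by move=> f; apply: CXP => x; exact: addNr. Qed.

HB.instance Definition _ :=
  GRing.isZmodule.Build CX CX_addA CX_addC CX_add0 CX_addN.

Fact CX_scaleA a b f : CX_scale a (CX_scale b f) = CX_scale (a * b) f.
Proof. by apply: CXP => x; exact: mulrA. Qed.
Fact CX_scale1 : left_id 1 CX_scale.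
Proof. by move=> f; apply: CXP => x; exact: mul1r. Qed.
Fact CX_scaleDr : right_distributive CX_scale +%R.
Proof. by move=> a f g; apply: CXP => x; exact: mulrDr. Qed.
Fact CX_scaleDl f : {morph CX_scale^~ f : a b / a + b}.
Proof. by move=> a b; apply: CXP => x; exact: mulrDl. Qed.

HB.instance Definition _ := GRing.Zmodule_isLmodule.Build R[i] CX
  CX_scaleA CX_scale1 CX_scaleDr CX_scaleDl.

Fact CX_mulA : associative CX_mul.
Proof. by move=> f g h; apply: CXP => x; exact: mulrA. Qed.
Fact CX_mul1 : left_id (CX_cst 1) CX_mul.
Proof. by move=> f; apply: CXP => x; exact: mul1r. Qed.
Fact CX_mulr1 : right_id (CX_cst 1) CX_mul.
Proof. by move=> f; apply: CXP => x; exact: mulr1. Qed.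
Fact CX_mul_linearl (a : R[i]) f g h :
  CX_mul (a *: f + g) h = a *: CX_mul f h + CX_mul g h.
Proof.
apply: CXP => x; rewrite -[LHS]/((a * f x + g x) * h x : C).
by rewrite mulrDl -mulrA.
Qed.
Fact CX_mul_linearr (a : R[i]) f g h :
  CX_mul f (a *: g + h) = a *: CX_mul f g + CX_mul f h.
Proof.
apply: CXP => x; rewrite -[LHS]/(f x * (a * g x + h x) : C).
by rewrite mulrDr mulrCA.
Qed.
Fact CX_starK : involutive CX_star.
Proof. by move=> f; apply: CXP => x; exact: conjCK. Qed.
Fact CX_star_semilinear (a : R[i]) f g :
  CX_star (a *: f + g) = a^* *: CX_star f + CX_star g.
Proof.
apply: CXP => x; rewrite -[LHS]/((a * f x + g x)^*).
by rewrite rmorphD rmorphM.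
Qed.
Fact CX_starM f g : CX_star (CX_mul f g) = CX_mul (CX_star g) (CX_star f).
Proof.
apply: CXP => x; rewrite -[LHS]/((f x * g x)^*).
by rewrite rmorphM mulrC.
Qed.

HB.instance Definition _ := Lmodule_isStarAlgebra.Build R CX
  CX_mulA CX_mul1 CX_mulr1 CX_mul_linearl CX_mul_linearr
  CX_starK CX_star_semilinear CX_starM.

End ContinuousFunctions.

Definition CX_comp (R : realType) (X Y : topologicalType)
  (f : CX R Y) (p : continuousType X Y) : CX R X := f \o p.

Record homeomorphism (X : topologicalType) := Homeomorphism {
  homeo_fun :> continuousType X X;
  homeo_inv : continuousType X X;
  homeoK : cancel homeo_fun homeo_inv;
  homeo_invK : cancel homeo_inv homeo_fun
}.

(* C(X) x| Z for a homeomorphism of a compact space X: the C*-algebra with its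
   canonical maps, specified (uniquely up to isomorphism) by its universal
   property among unital C*-algebras. *)

Definition covariant (R : realType) (X : topologicalType)
    (phi : homeomorphism X) (A : starAlgType R) (k : CX R X -> A) (v : A) :=
  forall f, star v *a k f *a v = k (CX_comp f phi).

Record crossedProduct (R : realType) (X : topologicalType)
    (phi : homeomorphism X) := CrossedProduct {
  cp_alg :> cstarType R;
  cp_incl : CX R X -> cp_alg;
  cp_unit : cp_alg;
  cp_incl_hom : star_hom cp_incl;
  cp_unitary : unitary cp_unit;
  cp_covariant : covariant phi cp_incl cp_unit;
  cp_generates : generates (range cp_incl `|` [set cp_unit]);
  cp_universal : forall (B : cstarType R) (k : CX R X -> B) (v : B),
    star_hom k -> unitary v -> covariant phi k v ->
    exists psi : cp_alg -> B,
      [/\ star_hom psi, forall f, psi (cp_incl f) = k f & psi cp_unit = v]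
}.

Record rotationAlgebra (R : realType) (theta : R) := RotationAlgebra {
  rot_alg :> cstarType R;
  rot_U : rot_alg;
  rot_V : rot_alg;
  rot_U_unitary : unitary rot_U;
  rot_V_unitary : unitary rot_V;
  rot_comm : rot_V *a rot_U = expi (2 * pi * theta) *: (rot_U *a rot_V);
  rot_generates : generates [set rot_U; rot_V];
  rot_universal : forall (B : cstarType R) (u v : B),
    unitary u -> unitary v -> v *a u = expi (2 * pi * theta) *: (u *a v) ->
    exists psi : rot_alg -> B,
      [/\ star_hom psi, psi rot_U = u & psi rot_V = v]
}.

(* Complex Hilbert spaces; the inner product is linear in its first argument. *)

HB.mixin Record CompleteNormedModule_isHilbert (R : realType) H
    of CompleteNormedModule R[i] H := {
  hdot : H -> H -> R[i];
  hdot_linear : forall (a : R[i]) (x y z : H),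
    hdot (a *: x + y) z = a * hdot x z + hdot y z;
  hdot_conj : forall x y : H, hdot y x = (hdot x y)^*;
  hdot_norm : forall x : H, hdot x x = `|x| ^+ 2
}.

#[short(type="hilbertType")]
HB.structure Definition Hilbert (R : realType) :=
  {H of CompleteNormedModule R[i] H & CompleteNormedModule_isHilbert R H}.

Section ComplexHilbert.
Variable R : realType.
Implicit Types x y z : R[i].

Definition complex_dot x y : R[i] := x * y^*.

Fact complex_dot_linear (a : R[i]) x y z :
  complex_dot (a *: x + y) z = a * complex_dot x z + complex_dot y z.
Proof. by rewrite /complex_dot mulrA; exact: mulrDl. Qed.
Fact complex_dot_conj x y : complex_dot y x = (complex_dot x y)^*.
Proof.
suff E (a b : R[i]) : b * a^* = (a * b^*)^* by exact: E.
by rewrite rmorphM /= conjCK mulrC.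
Qed.
Fact complex_dot_norm x : complex_dot x x = `|x| ^+ 2.
Proof.
suff E (a : R[i]) : a * a^* = `|a| ^+ 2 by exact: E.
by rewrite normCK.
Qed.

HB.instance Definition _ := CompleteNormedModule_isHilbert.Build R R[i]
  complex_dot_linear complex_dot_conj complex_dot_norm.

End ComplexHilbert.

Section Representations.
Variable R : realType.

(* *-homomorphisms into the bounded operators on [H], not required to be
   unital. *)
Record representation (A : starAlgType R) (H : hilbertType R)
    (pi : A -> H -> H) : Prop := Representation {
  rep_op_linear : forall a, linear (pi a);
  rep_op_bounded : forall a, continuous (pi a);
  rep_linear : forall (c : R[i]) a b x,
    pi (c *: a + b) x = c *: pi a x + pi b x;
  rep_mul : forall a b x, pi (a *a b) x = pi a (pi b x);
  rep_star : forall a x y, hdot (pi (star a) x) y = hdot x (pi a y)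
}.

Definition linear_subspace (H : hilbertType R) (S : set H) : Prop :=
  S 0 /\ forall (c : R[i]) x y, S x -> S y -> S (c *: x + y).

(* The zero representation on a line is not irreducible. *)
Definition irreducible (A : starAlgType R) (H : hilbertType R)
    (pi : A -> H -> H) : Prop :=
  [/\ representation pi,
      exists a x, pi a x <> 0
    & forall S : set H, closed S -> linear_subspace S ->
        (forall a x, S x -> S (pi a x)) -> S = [set 0] \/ S = setT].

Definition unitarily_equivalent (A : starAlgType R) (H K : hilbertType R)
    (pi : A -> H -> H) (sigma : A -> K -> K) : Prop :=
  exists W : H -> K,
    [/\ linear W, bijective W,
        forall x y, hdot (W x) (W y) = hdot x y
      & forall a x, W (pi a x) = sigma a (W x)].

(* The evaluation character f |-> f w of C(X), acting on the Hilbert space C. *)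
Definition nu (X : topologicalType) (w : X) (f : CX R X) : R[i] -> R[i] :=
  fun x => f w * x.

End Representations.

Section DiskAndCircles.
Variable R : realType.
Local Notation C := R[i].

Definition disk_set : set C := [set z | `|z| <= 1].
Definition circle_set (r : {i01 R}) : set C := [set z | `|z| = (r%:num)%:C].

Definition disk : topologicalType := set_type disk_set.
Definition circle (r : {i01 R}) : topologicalType := set_type (circle_set r).

Section Rotation.
Variables (S : set C) (S_inv : forall z w : C, `|w| = `|z| -> S z -> S w).

Fact rotate_subproof theta (x : S) :
  (expi (2 * pi * theta) * set_val x : C) \in S.
Proof.
apply/mem_set; apply: (S_inv _ (set_mem (valP x))).
by rewrite normrM norm_expi mul1r.
Qed.

Definition rotate theta (x : S) : S :=
  exist (fun z => z \in S) _ (rotate_subproof theta x).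

Fact rotate_continuous theta : continuous (rotate theta).
Proof.
apply: continuous_comp_initial => x /=.
apply: (@continuousM _ _ (fun=> expi _) (fun x : S => set_val x : C)).
  exact: cst_continuous.
exact: initial_continuous.
Qed.

Definition rotate_cts theta : continuousType S S :=
  mkcts (@rotate_continuous theta).

Fact rotateK theta : cancel (rotate theta) (rotate (- theta)).
Proof.
by move=> x; apply: val_inj; rewrite /= mulrA mulrN expiNK mul1r.
Qed.
Fact rotateNK theta : cancel (rotate (- theta)) (rotate theta).
Proof. by move=> x; rewrite -{1}(opprK theta) rotateK. Qed.

(* z |-> e^(2 i pi theta) z *)
Definition rotation theta : homeomorphism S :=
  @Homeomorphism S (rotate_cts theta) (rotate_cts (- theta))
    (rotateK theta) (rotateNK theta).

End Rotation.

Fact disk_inv (z w : C) : `|w| = `|z| -> disk_set z -> disk_set w.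
Proof. by rewrite /disk_set /= => ->. Qed.
Fact circle_inv r (z w : C) : `|w| = `|z| -> circle_set r z -> circle_set r w.
Proof. by rewrite /circle_set /= => ->. Qed.

Definition disk_rotation theta : homeomorphism disk := rotation disk_inv theta.
Definition circle_rotation r theta : homeomorphism (circle r) :=
  rotation (@circle_inv r) theta.

Fact circle_disk_subproof r (x : circle r) : set_val x \in disk_set.
Proof.
apply/mem_set; rewrite /disk_set /= (set_mem (valP x)).
by rewrite -[1]/(1%:C) lecR.
Qed.
Definition circle_disk r (x : circle r) : disk :=
  exist (fun z => z \in disk_set) _ (circle_disk_subproof x).
Fact circle_disk_continuous r : continuous (@circle_disk r).
Proof. by apply: continuous_comp_initial; exact: initial_continuous. Qed.

Definition restrict_circle r (f : CX R disk) : CX R (circle r) :=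
  CX_comp f (mkcts (@circle_disk_continuous r)).

Fact circle_coord_continuous r : continuous (fun x : circle r => set_val x : C).
Proof. exact: initial_continuous. Qed.

(* The function z |-> z. *)
Definition circle_coord r : CX R (circle r) := mkCX (@circle_coord_continuous r).

End DiskAndCircles.

Section QuotientMaps.
Variables (R : realType) (theta : R).

Definition restriction_map (D : crossedProduct R (disk_rotation theta))
    (r : {i01 R}) (G : crossedProduct R (circle_rotation r theta))
    (xi : D -> G) : Prop :=
  [/\ star_hom xi,
      forall f, xi (cp_incl D f) = cp_incl G (restrict_circle r f)
    & xi (cp_unit D) = cp_unit G].

Definition rotation_identification (r : {i01 R})
    (G : crossedProduct R (circle_rotation r theta))
    (A : rotationAlgebra theta) (iota : G -> A) : Prop :=
  [/\ star_iso iota, iota (cp_unit G) = rot_U A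
    & iota (cp_incl G (circle_coord r)) = (r%:num)%:C *: rot_V A].

(* [circle 1%:i01] is the unit circle T. *)
Definition torus_identification
    (G : crossedProduct R (circle_rotation 0%:i01 theta))
    (iota : G -> CX R (circle (1%:i01 : {i01 R}))) : Prop :=
  star_iso iota /\ iota (cp_unit G) = circle_coord 1%:i01.

End QuotientMaps.

(* Main.v *)
Require Import Defs.
From HB Require Import structures.
From mathcomp Require Import all_boot all_order all_algebra.
From mathcomp Require Import all_classical all_reals all_analysis.
From mathcomp Require Import complex.
From mathcomp Require Import ring lra.

Set Implicit Arguments.
Unset Strict Implicit.
Unset Printing Implicit Defensive.

Import Order.TTheory GRing.Theory Num.Theory.
Import numFieldNormedType.Exports.

Local Open Scope classical_set_scope.
Local Open Scope complex_scope.
Local Open Scope ring_scope.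

(** The function [|z|] on the disk is invariant under the rotation, so all
    functions of [|z|] are central in the crossed product of the disk. In an
    irreducible representation [pi] the kernel of a central element is an
    invariant closed subspace, so of two central elements with product zero one
    is killed ([irr_central_prime]). A representation of continuous functions on
    a compact space with this property is the evaluation at a point
    ([CX_rep_character]); applied to functions of [|z|], this gives a radius [r]
    such that [pi] kills every function that vanishes on the circle of radius
    [r] ([irr_radius]).

    Every function on the circle extends to the disk ([restrict_circle_surj]),
    so [pi] defines a covariant pair on the circle, with values in the
    C*-algebra of bounded operators, and the universal property of the crossed
    product of the circle factors [pi] through [xi r] ([disk_rep_factor]). If
    [r > 0] this is a representation of the rotation algebra. If [r = 0] it is
    an irreducible representation of the commutative algebra of functions on the
    unit circle, which is again a point evaluation, on a line ([irr_CX_nu]).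

    The converse and the statement on unitary equivalence transport invariant
    subspaces and intertwiners along [xi r] by checking them on generators
    ([irr_comp], [intertwiner_generates]). This needs representations of
    C*-algebras to be continuous, and they are: they are contractive
    ([rep_norm]), since [c^2 - a^* a] is of the form [b^* b] when [c > |a|],
    with [b] obtained from a fixed-point construction of square roots
    ([cstar_sqrt]). *)

(** * Real-valued norms and Hilbert space geometry *)

Section RealNorm.
Variable R : realType.

(** Norms live in the partially ordered field [R[i]]; their real values give
    access to total order and real arithmetic. *)
Definition nrm (V : normedModType R[i]) (x : V) : R := complex.Re `|x|.

Section Theory.
Variable V : normedModType R[i].
Implicit Types x y z : V.

Lemma nrmE x : `|x| = (nrm x)%:C.
Proof.
rewrite /nrm; have := normr_ge0 x; case: `|x| => a b /=.
by rewrite lecE /= => /andP[/eqP -> _].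
Qed.

Lemma nrm_ge0 x : 0 <= nrm x.
Proof. by rewrite -lecR -nrmE normr_ge0. Qed.

Lemma nrmD x y : nrm (x + y) <= nrm x + nrm y.
Proof. by rewrite -lecR rmorphD /= -!nrmE ler_normD. Qed.

Lemma nrmN x : nrm (- x) = nrm x.
Proof. by rewrite /nrm normrN. Qed.

Lemma nrm_distC x y : nrm (x - y) = nrm (y - x).
Proof. by rewrite -nrmN opprB. Qed.

Lemma nrm0 : nrm (0 : V) = 0.
Proof. by rewrite /nrm normr0. Qed.

Lemma nrm0_eq x : nrm x = 0 -> x = 0.
Proof. by move=> x0; apply/normr0_eq0; rewrite nrmE x0. Qed.

Lemma nrm_gt0 x : x <> 0 -> 0 < nrm x.
Proof.
by move=> x0; rewrite lt_neqAle nrm_ge0 andbT eq_sym; apply/eqP => /nrm0_eq.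
Qed.

Lemma nrmZ (a : R[i]) x : nrm (a *: x) = nrm (a : R[i]) * nrm x.
Proof.
by apply/(@complexI R); rewrite rmorphM /= -!nrmE normrZ.
Qed.

Lemma nrm_small x : (forall e, 0 < e -> nrm x <= e) -> x = 0.
Proof.
move=> xe; apply: nrm0_eq; apply/eqP; rewrite eq_le nrm_ge0 andbT.
by apply/ler_addgt0Pr => e e0; rewrite add0r xe.
Qed.

Lemma nrm_small_scaled x (M : R) :
  (forall e, 0 < e -> nrm x <= e * M) -> x = 0.
Proof.
move=> xe; apply: nrm_small => e e0.
have M0 : 0 < `|M| + 1 by rewrite ltr_wpDl.
apply: (le_trans (xe (e / (`|M| + 1)) (divr_gt0 e0 M0))).
rewrite mulrAC ler_pdivrMr // ler_wpM2l ?(ltW e0) //.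
by rewrite (le_trans (ler_norm M)) // lerDl.
Qed.

Lemma nrm_dist_le x y : `|nrm x - nrm y| <= nrm (x - y).
Proof.
rewrite ler_norml; apply/andP; split.
  rewrite lerNl opprB lerBlDr -{1}(subrK x y) (le_trans (nrmD _ _)) //.
  by rewrite nrm_distC.
by rewrite lerBlDr -{1}(subrK y x) (le_trans (nrmD _ _)).
Qed.

Lemma gt0_realC (e : R[i]) : 0 < e -> exists2 d : R, 0 < d & e = d%:C.
Proof.
case: e => a b; rewrite ltcE /= => /andP[/eqP b0 a0]; exists a => //.
by rewrite b0.
Qed.

Lemma cvg_nrmP (T : Type) (F : set_system T) (FF : Filter F) (f : T -> V) l :
  (forall e, 0 < e -> \forall t \near F, nrm (l - f t) < e) <-> f @ F --> l.
Proof.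
split=> [fl|/cvgrPdist_lt fl e e0].
  apply/cvgrPdist_lt => _ /gt0_realC[e /fl fle ->].
  by apply: filterS fle => t; rewrite nrmE ltcR.
have : 0 < e%:C by rewrite ltcR.
by move=> /fl; apply: filterS => t; rewrite nrmE ltcR.
Qed.

Lemma nbhs_nrm x e : 0 < e -> nbhs x [set y | nrm (x - y) < e].
Proof.
by move=> e0; apply: ((cvg_nrmP _ (fun y : V => y) x).2 _ e e0); exact: cvg_id.
Qed.

Lemma closed_nrmP (S : set V) :
  closed S <->
  forall x, (forall e, 0 < e -> exists2 y, S y & nrm (x - y) < e) -> S x.
Proof.
split=> [cS x xS|H x xS].
  apply: cS => B /nbhs_ballP[e' /= /gt0_realC[e e0 ->] eB].
  have [y Sy xy] := xS e e0; exists y; split => //.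
  by apply: eB; rewrite -ball_normE /= nrmE ltcR.
apply: H => e e0; have [y [Sy xy]] := xS _ (nbhs_nrm x e0).
by exists y.
Qed.

Lemma cauchy_nrmP (F : set_system V) (FF : ProperFilter F) :
  cauchy F <-> forall e, 0 < e ->
    exists2 A, F A & forall x y, A x -> A y -> nrm (x - y) < e.
Proof.
split=> [/cauchy_ballP Fc e e0|Fe].
  have e2 : 0 < (e / 2)%:C by rewrite ltcR divr_gt0.
  have := Fc _ e2; rewrite !near_simpl => -[[A B] /= [FA FB] AB].
  have [z Az] := filter_ex FA.
  have zB x : B x -> nrm (z - x) < e / 2.
    by move=> Bx; have := AB (z, x) (conj Az Bx); rewrite -ball_normE /= nrmE ltcR.
  exists B => // x y /zB zx /zB zy; rewrite -(subrKA z).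
  by rewrite (le_lt_trans (nrmD _ _)) // [ltRHS](splitr e) ltrD // nrm_distC.
apply/cauchy_ballP => _ /gt0_realC[e /Fe[A FA Ae] ->].
exists (A, A) => // -[x y] [/= Ax Ay].
by rewrite -ball_normE /= nrmE ltcR Ae.
Qed.

End Theory.

Lemma nrmcR (a : R) : nrm (a%:C : R[i]) = `|a|.
Proof. by rewrite /nrm normc_def /= expr0n addr0 sqrtr_sqr. Qed.

Lemma nrmcM (a b : R[i]) : nrm (a * b : R[i]) = nrm (a : R[i]) * nrm (b : R[i]).
Proof. exact: nrmZ. Qed.

Lemma conj_real (a : R) : (a%:C)^* = a%:C :> R[i].
Proof. exact: conjc_real. Qed.

Lemma mul_conj (a : R[i]) : a * a^* = (nrm (a : R[i]) ^+ 2)%:C.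
Proof.
have E : a * a^* = `|a| ^+ 2 by rewrite normCK.
by rewrite E; rewrite (nrmE (a : R[i])) rmorphXn.
Qed.

End RealNorm.

Section HilbertGeometry.
Variables (R : realType) (H : hilbertType R).
Implicit Types x y z : H.

Lemma hdotDl x y z : hdot (x + y) z = hdot x z + hdot y z.
Proof. by have := hdot_linear 1 x y z; rewrite scale1r mul1r. Qed.

Lemma hdot0l x : hdot 0 x = 0.
Proof. by apply: (addrI (hdot 0 x)); rewrite -hdotDl !addr0. Qed.

Lemma hdotZl a x y : hdot (a *: x) y = a * hdot x y.
Proof. by have := hdot_linear a x 0 y; rewrite addr0 hdot0l addr0. Qed.

Lemma hdotNl x y : hdot (- x) y = - hdot x y.
Proof. by rewrite -scaleN1r hdotZl mulN1r. Qed.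

Lemma hdotDr x y z : hdot x (y + z) = hdot x y + hdot x z.
Proof. by rewrite hdot_conj hdotDl rmorphD /= -!hdot_conj. Qed.

Lemma hdotZr a x y : hdot x (a *: y) = a^* * hdot x y.
Proof. by rewrite hdot_conj hdotZl rmorphM /= -hdot_conj. Qed.

Lemma hdotNr x y : hdot x (- y) = - hdot x y.
Proof. by rewrite hdot_conj hdotNl rmorphN /= -hdot_conj. Qed.

Lemma hdot0r x : hdot x 0 = 0.
Proof. by rewrite hdot_conj hdot0l rmorph0. Qed.

Lemma hdotxx x : hdot x x = (nrm x ^+ 2)%:C.
Proof. by rewrite hdot_norm nrmE rmorphXn. Qed.

Lemma hdot_eq x y : (forall z, hdot x z = hdot y z) -> x = y.
Proof.
move=> xy; apply/eqP; rewrite -subr_eq0; apply/eqP/nrm0_eq.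
have := hdotxx (x - y); rewrite {1}hdotDl hdotNl xy subrr => /complexI/esym/eqP.
by rewrite expf_eq0 => /eqP.
Qed.

(** Expanding the square norm of [y^2 x - <x,y> y], with [y^2] the squared
    norm of [y], avoids dividing by it. *)
Lemma cauchy_schwarz x y : nrm (hdot x y : R[i]) <= nrm x * nrm y.
Proof.
have [->|/eqP/nrm_gt0 y0] := eqVneq y 0; first by rewrite hdot0r !nrm0 mulr0.
set c := hdot x y; set n := nrm y ^+ 2.
have n0 : 0 < n by rewrite exprn_gt0.
have E : (nrm (n%:C *: x - c *: y) ^+ 2)%:C =
    (n ^+ 2 * nrm x ^+ 2 - n * nrm (c : R[i]) ^+ 2)%:C.
  rewrite -hdotxx !(hdotDl, hdotDr, hdotNl, hdotNr, hdotZl, hdotZr) !hdotxx.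
  rewrite [hdot y x]hdot_conj -/c -/n conj_real.
  rewrite rmorphB /= !(rmorphM _ (n ^+ 2)) !(rmorphM _ n) /= -mul_conj rmorphXn.
  by ring.
move/complexI: E => E.
have : 0 <= n ^+ 2 * nrm x ^+ 2 - n * nrm (c : R[i]) ^+ 2.
  by rewrite -E sqr_ge0.
have -> : n ^+ 2 * nrm x ^+ 2 - n * nrm (c : R[i]) ^+ 2 =
    n * ((nrm x * nrm y) ^+ 2 - nrm (c : R[i]) ^+ 2) by rewrite /n; ring.
rewrite pmulr_rge0 // subr_ge0 ler_sqr //.
  by rewrite nnegrE nrm_ge0.
by rewrite nnegrE mulr_ge0 // nrm_ge0.
Qed.

End HilbertGeometry.

(** * Star algebras and square roots in C*-algebras *)

Section LinearMaps.
Variables (K : pzRingType) (U V : lmodType K) (f : U -> V) (fL : linear f).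

Lemma linD x y : f (x + y) = f x + f y.
Proof. by have := fL 1 x y; rewrite !scale1r. Qed.

Lemma lin0 : f 0 = 0.
Proof. by apply: (addrI (f 0)); rewrite -linD !addr0. Qed.

Lemma linZ a x : f (a *: x) = a *: f x.
Proof. by have := fL a x 0; rewrite lin0 !addr0. Qed.

Lemma linN x : f (- x) = - f x.
Proof. by rewrite -scaleN1r linZ scaleN1r. Qed.

Lemma linB x y : f (x - y) = f x - f y.
Proof. by rewrite linD linN. Qed.

End LinearMaps.

Section StarAlgebraTheory.
Variables (R : realType) (A : starAlgType R).
Implicit Types x y z : A.

Lemma amul_linl z : linear (fun x : A => x *a z).
Proof. by move=> a x y; exact: amul_linearl. Qed.

Lemma amul_linr z : linear (fun x : A => z *a x).
Proof. by move=> a x y; exact: amul_linearr. Qed.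

Definition amulBl x y z : (x - y) *a z = x *a z - y *a z :=
  linB (amul_linl z) x y.
Definition amulBr z x y : z *a (x - y) = z *a x - z *a y :=
  linB (amul_linr z) x y.
Definition amulZl a x z : (a *: x) *a z = a *: (x *a z) :=
  linZ (amul_linl z) a x.
Definition amulZr a z x : z *a (a *: x) = a *: (z *a x) :=
  linZ (amul_linr z) a x.

Lemma starD x y : star (x + y) = star x + star y.
Proof. by have := star_semilinear 1 x y; rewrite rmorph1 !scale1r. Qed.

Lemma star0 : star (0 : A) = 0.
Proof. by apply: (addrI (star 0)); rewrite -starD !addr0. Qed.

Lemma starZ (a : R[i]) x : star (a *: x) = a^* *: star x.
Proof. by have := star_semilinear a x 0; rewrite star0 !addr0. Qed.

Lemma starB x y : star (x - y) = star x - star y.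
Proof. by rewrite starD -scaleN1r starZ rmorphN rmorph1 scaleN1r. Qed.

Lemma star1 : star (aone : A) = aone.
Proof. by rewrite -[LHS]amul1l -{1}[aone]starK -starM amul1l starK. Qed.

End StarAlgebraTheory.

Section CStarTheory.
Variables (R : realType) (A : cstarType R).
Implicit Types x y z : A.

Lemma nrm_amul x y : nrm (x *a y) <= nrm x * nrm y.
Proof. by rewrite -lecR rmorphM /= -!nrmE cstar_normM. Qed.

Lemma nrm_star_amul x : nrm (star x *a x) = nrm x ^+ 2.
Proof. by apply/(@complexI R); rewrite rmorphXn /= -!nrmE cstar_norm. Qed.

Lemma nrm_star x : nrm (star x) = nrm x.
Proof.
have le y : nrm y <= nrm (star y).
  have [->|/eqP/nrm_gt0 y0] := eqVneq y 0; first by rewrite nrm0 nrm_ge0.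
  by rewrite -(ler_pM2r y0) -expr2 -nrm_star_amul nrm_amul.
by apply/eqP; rewrite eq_le le -{2}[x]starK le.
Qed.

End CStarTheory.

(** The square root below is a limit of fixed-point iterates, whose increments
    decay geometrically. *)
Lemma geometric_cvg (R : realType) (V : completeNormedModType R[i])
    (u : nat -> V) (C q : R) : 0 <= q < 1 ->
    (forall n, nrm (u n.+1 - u n) <= C * q ^+ n) ->
  exists l : V, u @ \oo --> l.
Proof.
move=> /andP[q0 q1] uC.
have C0 : 0 <= C.
  by have := uC 0%N; rewrite expr0 mulr1; apply: le_trans; exact: nrm_ge0.
have q1' : 0 < 1 - q by rewrite subr_gt0.
pose D := C / (1 - q).
have D0 : 0 <= D by rewrite divr_ge0 // ltW.
have DE : C = D * (1 - q) by rewrite /D divfK // gt_eqF.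
have dist n k : nrm (u (n + k)%N - u n) <= D * q ^+ n * (1 - q ^+ k).
  elim: k => [|k IH]; first by rewrite addn0 subrr nrm0 expr0 subrr mulr0.
  rewrite addnS -(subrKA (u (n + k)%N)).
  apply: (le_trans (nrmD _ _)); apply: (le_trans (lerD (uC _) IH)).
  by rewrite DE exprD exprS le_eqVlt; apply/orP; left; apply/eqP; ring.
have dist' n k : nrm (u (n + k)%N - u n) <= D * q ^+ n.
  apply: (le_trans (dist n k)); rewrite ler_piMr //.
    by rewrite mulr_ge0 // exprn_ge0.
  by rewrite gerBl exprn_ge0.
have small e : 0 < e -> exists N, D * q ^+ N < e.
  move=> e0; have /cvgrPdist_lt/(_ (e / (D + 1))) : (fun n => q ^+ n) @ \oo --> (0 : R).
    by apply: cvg_expr; rewrite ger0_norm.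
  case=> [|N _ /(_ N (leqnn N))]; first by rewrite divr_gt0 // ltr_wpDl.
  rewrite sub0r normrN ger0_norm ?exprn_ge0 // => qN; exists N.
  apply: (@le_lt_trans _ _ ((D + 1) * q ^+ N)).
    by rewrite ler_wpM2r ?exprn_ge0 // lerDl.
  by rewrite mulrC -ltr_pdivlMr // ltr_wpDl.
suff /cauchy_cvg/cvg_ex : cauchy (u @ \oo) by [].
apply/cauchy_nrmP => e e0.
have [N qN] : exists N, D * q ^+ N < e / 2 by apply: small; rewrite divr_gt0.
exists (u @` [set n | (N <= n)%N]); first by exists N => //= n /= Nn; exists n.
move=> _ _ [n /= Nn <-] [m /= Nm <-].
have near k : (N <= k)%N -> nrm (u k - u N) < e / 2.
  by move=> Nk; rewrite -(subnKC Nk); exact: le_lt_trans (dist' _ _) qN.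
rewrite -(subrKA (u N)) (le_lt_trans (nrmD _ _)) //.
by rewrite [ltRHS](splitr e) ltrD ?near // nrm_distC near.
Qed.

(** The iteration [b := (h + b^2) / 2] preserves self-adjointness and contracts
    the ball of radius [q]; its fixed point [l] satisfies [(1 - l)^2 = 1 - h].
    This replaces the continuous functional calculus. *)
Lemma cstar_sqrt (R : realType) (A : cstarType R) (h : A) (q : R) :
  star h = h -> nrm h <= q -> q < 1 ->
  exists2 d : A, star d = d & d *a d = aone - h.
Proof.
move=> hs hq q1.
have q0 : 0 <= q by exact: le_trans (nrm_ge0 h) hq.
pose F (b : A) := ((2^-1 : R)%:C : R[i]) *: (h + b *a b).
have nhalf : nrm ((2^-1 : R)%:C : R[i]) = 2^-1.
  by rewrite nrmcR ger0_norm // invr_ge0.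
have Fdist b c : nrm (F b - F c) <= 2^-1 * (nrm b + nrm c) * nrm (b - c).
  have -> : F b - F c = ((2^-1 : R)%:C : R[i]) *: (b *a (b - c) + (b - c) *a c).
    rewrite /F -scalerBr; congr (_ *: _).
    by rewrite amulBr amulBl addrA subrK opprD addrACA subrr add0r.
  rewrite nrmZ nhalf -mulrA ler_wpM2l ?invr_ge0 //.
  rewrite (le_trans (nrmD _ _)) // mulrDl lerD ?nrm_amul //.
  by rewrite [leRHS]mulrC nrm_amul.
pose u := fix u n := if n is m.+1 then F (u m) else 0 : A.
have us n : star (u n) = u n.
  elim: n => [|n IH] /=; first exact: star0.
  by rewrite /F starZ conj_real starD starM hs IH.
have uq n : nrm (u n) <= q.
  elim: n => [|n IH] /=; first by rewrite nrm0.
  rewrite /F nrmZ nhalf ler_pdivrMl //.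
  apply: (le_trans (nrmD _ _)); apply: (le_trans (lerD hq (nrm_amul _ _))).
  have : nrm (u n) * nrm (u n) <= q * 1.
    by apply: ler_pM; rewrite ?nrm_ge0 // (le_trans IH) // ltW.
  by lra.
have udist n : nrm (u n.+1 - u n) <= 1 * q ^+ n.
  elim: n => [|n IH].
    by rewrite expr0 mulr1 /= subr0 -[F 0]/(u 1%N) (le_trans (uq 1%N)) // ltW.
  rewrite exprS [leLHS]/(nrm (F (u n.+1) - F (u n))) mul1r.
  rewrite (le_trans (Fdist _ _)) // ler_pM ?nrm_ge0 //.
  - by rewrite mulr_ge0 ?addr_ge0 ?nrm_ge0 ?invr_ge0.
  - by rewrite ler_pdivrMl // mulr_natl mulr2n lerD.
  - by rewrite -[leRHS]mul1r.
have [|l /(cvg_nrmP _ _ _).2 ul] := geometric_cvg _ udist.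
  by rewrite q0 q1.
have apx e : 0 < e -> exists n, nrm (l - u n) < e /\ nrm (l - u n.+1) < e.
  move=> /ul[N _ uN]; exists N; split; first by apply: uN => /=.
  by apply: (uN N.+1) => /=.
have ls : star l = l.
  apply/eqP; rewrite -subr_eq0; apply/eqP/nrm_small => e e0.
  have [n [ln _]] := apx (e / 2) (divr_gt0 e0 (ltr0Sn _ 1)).
  rewrite -(subrKA (u n)) -{1}(us n) -starB (le_trans (nrmD _ _)) //.
  rewrite nrm_star [X in _ + X]nrm_distC; lra.
have ll : nrm l <= 1.
  apply/ler_addgt0Pr => e e0; have [n [ln _]] := apx e e0.
  rewrite -(subrK (u n) l) (le_trans (nrmD _ _)) //.
  by rewrite addrC lerD ?ltW // (le_lt_trans (uq n)).
have lF : l = F l.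
  apply/eqP; rewrite -subr_eq0; apply/eqP/nrm_small => e e0.
  have [n [ln lSn]] := apx (e / 2) (divr_gt0 e0 (ltr0Sn _ 1)).
  rewrite -(subrKA (u n.+1)) (le_trans (nrmD _ _)) //.
  have := Fdist (u n) l; rewrite [nrm (u n - l)]nrm_distC -[F (u n)]/(u n.+1).
  have : 2^-1 * (nrm (u n) + nrm l) * nrm (l - u n) <= 1 * nrm (l - u n).
    rewrite ler_wpM2r ?nrm_ge0 //; have := uq n; lra.
  lra.
exists (aone - l); first by rewrite starB star1 ls.
have -> : h = l + l - l *a l.
  rewrite -[l in l + l]scale1r -scalerDl {1}lF /F scalerA.
  have -> : (1 + 1) * ((2^-1 : R)%:C : R[i]) = 1.
    rewrite -[1 + 1]/((1 + 1)%R) -(rmorph1 (real_complex R)) -rmorphD -rmorphM /=.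
    by congr (_%:C); lra.
  by rewrite scale1r addrK.
rewrite amulBl amul1l amulBr amul1r opprB opprD opprK.
by rewrite opprD -!addrA; congr (_ + (_ + _)); rewrite addrC.
Qed.

(** * The C*-algebra of bounded operators *)

Section BoundedOperators.
Variables (R : realType) (H : hilbertType R).

(** The adjoint is part of the definition, which spares the Riesz
    representation theorem; boundedness alone would give the same operators. *)
Definition bounded_adjointable (T : H -> H) : Prop :=
  [/\ linear T, exists M, forall x, nrm (T x) <= M * nrm x
    & exists T' : H -> H, forall x y, hdot (T x) y = hdot x (T' y)].

Record boundedOp := BoundedOp { bop_fun :> H -> H; bopP : bounded_adjointable bop_fun }.

Implicit Types (T S : boundedOp) (x y : H).

HB.instance Definition _ := gen_eqMixin boundedOp.
HB.instance Definition _ := gen_choiceMixin boundedOp.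

Lemma bop_ext T S : (forall x, T x = S x) -> T = S.
Proof.
case: T S => [T tP] [S sP] /= TS.
have ETS : T = S by apply/funext.
by case: _ / ETS sP => sP; congr BoundedOp; exact: Prop_irrelevance.
Qed.

Lemma bop_lin T : linear T. Proof. by case: (bopP T). Qed.

Definition bop_adj_fun T : H -> H :=
  let: And3 _ _ h := bopP T in projT1 (cid h).

Lemma bop_adjE T x y : hdot (T x) y = hdot x (bop_adj_fun T y).
Proof. by rewrite /bop_adj_fun; case: (bopP T) => _ _ h; exact: (projT2 (cid h)). Qed.

Lemma adj_linear (T T' : H -> H) :
  (forall x y, hdot (T x) y = hdot x (T' y)) -> linear T'.
Proof.
move=> TT' a x y; apply: hdot_eq => z.
rewrite [LHS]hdot_conj [RHS]hdot_conj; congr (_^*).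
by rewrite -TT' !(hdotDr, hdotZr) !TT'.
Qed.

Lemma adj_bounded (T T' : H -> H) (M : R) :
  (forall x y, hdot (T x) y = hdot x (T' y)) ->
  0 <= M -> (forall x, nrm (T x) <= M * nrm x) ->
  forall x, nrm (T' x) <= M * nrm x.
Proof.
move=> TT' M0 TM x.
have [->|/eqP/nrm_gt0 y0] := eqVneq (T' x) 0.
  by rewrite nrm0 mulr_ge0 ?nrm_ge0.
rewrite -(ler_pM2r y0) -expr2.
have -> : nrm (T' x) ^+ 2 = nrm (hdot (T (T' x)) x : R[i]).
  by rewrite TT' hdotxx nrmcR ger0_norm // sqr_ge0.
rewrite (le_trans (cauchy_schwarz _ _)) // mulrAC ler_wpM2r ?nrm_ge0 //.
Qed.

Definition opn (T : H -> H) : R :=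
  inf [set M | 0 <= M /\ forall x, nrm (T x) <= M * nrm x].

Lemma opn_le (T : H -> H) (M : R) :
  0 <= M -> (forall x, nrm (T x) <= M * nrm x) -> opn T <= M.
Proof. by move=> M0 TM; apply: ge_inf => //; exists 0 => N []. Qed.

Lemma bop_bound_ex T : exists2 M, 0 <= M & forall x, nrm (T x) <= M * nrm x.
Proof.
have [_ [M TM] _] := bopP T; exists `|M| => // x.
by rewrite (le_trans (TM x)) // ler_wpM2r ?nrm_ge0 // ler_norm.
Qed.

Lemma opn_ge0 T : 0 <= opn T.
Proof.
have [M M0 TM] := bop_bound_ex T.
by apply: lb_le_inf => [|N []//]; exists M.
Qed.

Lemma opnP T x : nrm (T x) <= opn T * nrm x.
Proof.
have [->|/eqP/nrm_gt0 x0] := eqVneq x 0.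
  by rewrite (lin0 (bop_lin T)) !nrm0 mulr0.
rewrite -ler_pdivrMr //; have [M M0 TM] := bop_bound_ex T.
apply: lb_le_inf => [|N [N0 TN]]; first by exists M.
by rewrite ler_pdivrMr.
Qed.

Fact bop_adj_subproof T : bounded_adjointable (bop_adj_fun T).
Proof.
split.
- exact: adj_linear (bop_adjE T).
- exists (opn T) => x; apply: (adj_bounded (bop_adjE T)); first exact: opn_ge0.
  exact: opnP.
- by exists T => x y; rewrite hdot_conj -bop_adjE -hdot_conj.
Qed.
Definition bop_adj T := BoundedOp (bop_adj_subproof T).

Fact bop_add_subproof T S : bounded_adjointable (fun x => T x + S x).
Proof.
split.
- by move=> a x y; rewrite !bop_lin scalerDr addrACA.
- exists (opn T + opn S) => x; rewrite (le_trans (nrmD _ _)) // mulrDl.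
  by rewrite lerD ?opnP.
- exists (fun x => bop_adj T x + bop_adj S x) => x y.
  by rewrite hdotDl hdotDr !bop_adjE.
Qed.
Definition bop_add T S := BoundedOp (bop_add_subproof T S).

Fact bop_scale_subproof (a : R[i]) T : bounded_adjointable (fun x => a *: T x).
Proof.
split.
- by move=> b x y; rewrite bop_lin scalerDr !scalerA mulrC.
- exists (nrm (a : R[i]) * opn T) => x.
  by rewrite nrmZ -mulrA ler_wpM2l ?nrm_ge0 // opnP.
- exists (fun x => a^* *: bop_adj T x) => x y.
  by rewrite hdotZl hdotZr conjCK bop_adjE.
Qed.
Definition bop_scale a T := BoundedOp (bop_scale_subproof a T).

Fact bop_mul_subproof T S : bounded_adjointable (fun x => T (S x)).
Proof.
split.
- by move=> b x y; rewrite !bop_lin.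
- exists (opn T * opn S) => x.
  by rewrite (le_trans (opnP _ _)) // -mulrA ler_wpM2l ?opn_ge0 // opnP.
- by exists (fun x => bop_adj S (bop_adj T x)) => x y; rewrite !bop_adjE.
Qed.
Definition bop_mul T S := BoundedOp (bop_mul_subproof T S).

Fact bop_zero_subproof : bounded_adjointable (fun _ => 0).
Proof.
split.
- by move=> a x y; rewrite scaler0 addr0.
- by exists 0 => x; rewrite nrm0 mul0r.
- by exists (fun _ => 0) => x y; rewrite hdot0l hdot0r.
Qed.
Definition bop_zero := BoundedOp bop_zero_subproof.

Fact bop_one_subproof : bounded_adjointable (fun x => x).
Proof.
split => //.
- by exists 1 => x; rewrite mul1r.
- by exists id.
Qed.
Definition bop_one := BoundedOp bop_one_subproof.

Definition bop_opp T := bop_scale (-1) T.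

Fact bop_addA : associative bop_add.
Proof. by move=> T S U; apply: bop_ext => x; exact: addrA. Qed.
Fact bop_addC : commutative bop_add.
Proof. by move=> T S; apply: bop_ext => x; exact: addrC. Qed.
Fact bop_add0 : left_id bop_zero bop_add.
Proof. by move=> T; apply: bop_ext => x; exact: add0r. Qed.
Fact bop_addN : left_inverse bop_zero bop_opp bop_add.
Proof. by move=> T; apply: bop_ext => x /=; rewrite scaleN1r addNr. Qed.

HB.instance Definition _ :=
  GRing.isZmodule.Build boundedOp bop_addA bop_addC bop_add0 bop_addN.

Fact bop_scaleA a b T : bop_scale a (bop_scale b T) = bop_scale (a * b) T.
Proof. by apply: bop_ext => x; exact: scalerA. Qed.
Fact bop_scale1 : left_id 1 bop_scale.
Proof. by move=> T; apply: bop_ext => x; exact: scale1r. Qed.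
Fact bop_scaleDr : right_distributive bop_scale +%R.
Proof. by move=> a T S; apply: bop_ext => x; exact: scalerDr. Qed.
Fact bop_scaleDl T : {morph bop_scale^~ T : a b / a + b}.
Proof. by move=> a b; apply: bop_ext => x; exact: scalerDl. Qed.

HB.instance Definition _ := GRing.Zmodule_isLmodule.Build R[i] boundedOp
  bop_scaleA bop_scale1 bop_scaleDr bop_scaleDl.

Lemma opnD T S : opn (T + S : boundedOp) <= opn T + opn S.
Proof.
apply: opn_le => [|x]; first by rewrite addr_ge0 ?opn_ge0.
by rewrite (le_trans (nrmD _ _)) // mulrDl lerD ?opnP.
Qed.

Lemma opnZ_le (a : R[i]) T : opn (a *: T : boundedOp) <= nrm (a : R[i]) * opn T.
Proof.
apply: opn_le => [|x]; first by rewrite mulr_ge0 ?nrm_ge0 ?opn_ge0.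
by rewrite nrmZ -mulrA ler_wpM2l ?nrm_ge0 // opnP.
Qed.

Lemma opnZ (a : R[i]) T : opn (a *: T : boundedOp) = nrm (a : R[i]) * opn T.
Proof.
apply/eqP; rewrite eq_le opnZ_le andTb.
have [->|a0] := eqVneq a 0; first by rewrite nrm0 mul0r opn_ge0.
have /eqP/nrm_gt0 na0 := a0.
rewrite -ler_pdivlMl //; have := opnZ_le a^-1 (a *: T).
rewrite scalerA mulVf // scale1r.
suff -> : nrm (a^-1 : R[i]) = (nrm (a : R[i]))^-1 by [].
apply: (mulfI (lt0r_neq0 na0)); rewrite -nrmcM !mulfV // ?lt0r_neq0 //.
by rewrite -[1]/(1%:C) nrmcR normr1.
Qed.

Lemma opn0_eq T : opn T = 0 -> T = 0.
Proof.
move=> T0; apply: bop_ext => x; apply: nrm0_eq; apply/eqP.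
by rewrite eq_le nrm_ge0 andbT; have := opnP T x; rewrite T0 mul0r.
Qed.

Fact bop_ler_normD T S : (opn (T + S : boundedOp))%:C <= (opn T)%:C + (opn S)%:C :> R[i].
Proof. by rewrite -rmorphD lecR opnD. Qed.
Fact bop_normrZ (a : R[i]) T : (opn (a *: T : boundedOp))%:C = `|a| * (opn T)%:C.
Proof. by rewrite opnZ rmorphM /= -nrmE. Qed.
Fact bop_normr0_eq0 T : (opn T)%:C = 0 :> R[i] -> T = 0.
Proof. by move=> /complexI/opn0_eq. Qed.

HB.instance Definition _ := Lmodule_isNormed.Build R[i] boundedOp
  bop_ler_normD bop_normrZ bop_normr0_eq0.

End BoundedOperators.

Section BopStar.
Variables (R : realType) (H : hilbertType R).
Implicit Types (T S U : boundedOp H) (x y : H).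

Fact bop_mulA : associative (@bop_mul R H).
Proof. by move=> T S U; apply: bop_ext. Qed.
Fact bop_mul1l : left_id (bop_one H) (@bop_mul R H).
Proof. by move=> T; apply: bop_ext. Qed.
Fact bop_mul1r : right_id (bop_one H) (@bop_mul R H).
Proof. by move=> T; apply: bop_ext. Qed.
Fact bop_mul_linearl (a : R[i]) T S U :
  bop_mul (a *: T + S) U = a *: bop_mul T U + bop_mul S U.
Proof. by apply: bop_ext. Qed.
Fact bop_mul_linearr (a : R[i]) T S U :
  bop_mul T (a *: S + U) = a *: bop_mul T S + bop_mul T U.
Proof. by apply: bop_ext => x; exact: bop_lin. Qed.

Lemma bop_adj_unique T S :
  (forall x y, hdot (T x) y = hdot x (S y)) -> bop_adj T = S.
Proof.
move=> TS; apply: bop_ext => y; apply: hdot_eq => x.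
by rewrite [LHS]hdot_conj [RHS]hdot_conj -bop_adjE TS.
Qed.

Fact bop_starK : involutive (@bop_adj R H).
Proof.
move=> T; apply: bop_adj_unique => x y.
by rewrite hdot_conj -bop_adjE -hdot_conj.
Qed.
Fact bop_star_semilinear (a : R[i]) T S :
  bop_adj (a *: T + S) = a^* *: bop_adj T + bop_adj S.
Proof.
apply: bop_adj_unique => x y.
rewrite [bop_fun _ x]/(a *: T x + S x).
rewrite [bop_fun _ y]/(a^* *: bop_adj T y + bop_adj S y).
by rewrite hdotDl hdotDr hdotZl hdotZr conjCK !bop_adjE.
Qed.
Fact bop_starM T S : bop_adj (bop_mul T S) = bop_mul (bop_adj S) (bop_adj T).
Proof. by apply: bop_adj_unique => x y /=; rewrite !bop_adjE. Qed.

HB.instance Definition _ := Lmodule_isStarAlgebra.Build R (boundedOp H)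
  bop_mulA bop_mul1l bop_mul1r bop_mul_linearl bop_mul_linearr
  bop_starK bop_star_semilinear bop_starM.

Lemma bop_starE T x y : hdot (T x) y = hdot x (star T y).
Proof. exact: bop_adjE. Qed.

Lemma nrm_bop_le T (M : R) :
  0 <= M -> (forall x, nrm (T x) <= M * nrm x) -> nrm T <= M.
Proof. exact: opn_le. Qed.

Lemma nrm_bopP T x : nrm (T x) <= nrm T * nrm x.
Proof. exact: opnP. Qed.

Lemma bop_subE T S x : (T - S) x = T x - S x.
Proof. by rewrite -[- S x]scaleN1r. Qed.

Lemma nrm_bop_star_le T : nrm (star T) <= nrm T.
Proof.
apply: nrm_bop_le; first exact: nrm_ge0.
apply: (adj_bounded (bop_starE T)); first exact: nrm_ge0.
exact: nrm_bopP.
Qed.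

Lemma nrm_bop_mul T S : nrm (T *a S) <= nrm T * nrm S.
Proof.
apply: nrm_bop_le => [|x]; first by rewrite mulr_ge0 ?nrm_ge0.
rewrite [X in nrm X]/(T (S x)) (le_trans (nrm_bopP _ _)) // -mulrA.
by rewrite ler_wpM2l ?nrm_ge0 // nrm_bopP.
Qed.

Lemma nrm_bop_star_mul T : nrm (star T *a T) = nrm T ^+ 2.
Proof.
apply/eqP; rewrite eq_le; apply/andP; split.
  rewrite (le_trans (nrm_bop_mul _ _)) // expr2 ler_wpM2r ?nrm_ge0 //.
  exact: nrm_bop_star_le.
have n0 : 0 <= nrm (star T *a T) by exact: nrm_ge0.
rewrite -(sqr_sqrtr n0) ler_sqr ?nnegrE ?nrm_ge0 ?sqrtr_ge0 //.
apply: nrm_bop_le => [|x]; first exact: sqrtr_ge0.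
rewrite -ler_sqr ?nnegrE ?mulr_ge0 ?nrm_ge0 ?sqrtr_ge0 //.
rewrite exprMn sqr_sqrtr //.
have -> : nrm (T x) ^+ 2 = nrm (hdot x ((star T *a T) x) : R[i]).
  rewrite -[(star T *a T) x]/(star T (T x)) -bop_starE hdotxx nrmcR ger0_norm //.
  exact: sqr_ge0.
rewrite (le_trans (cauchy_schwarz _ _)) //.
rewrite [leRHS](_ : _ = nrm x * (nrm (star T *a T) * nrm x)); last by ring.
by rewrite ler_wpM2l ?nrm_ge0 // nrm_bopP.
Qed.

(** A Cauchy filter of operators converges uniformly on balls, and so does the
    filter of adjoints since [star] is contractive; the two limits are adjoint
    to each other. *)
Fact bop_complete (F : set_system (boundedOp H)) :
  ProperFilter F -> cauchy F -> cvg F.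
Proof.
move=> FF /cauchy_nrmP Fe.
have lim_ex (p : boundedOp H -> H -> H) :
    (forall T S x, nrm (p T x - p S x) <= nrm (T - S) * nrm x) ->
    exists L : H -> H, forall e, 0 < e -> \forall T \near F,
      forall x, nrm (L x - p T x) <= e * nrm x.
  move=> pB.
  have px x : exists l : H, (fun T => p T x) @ F --> l.
    suff /cauchy_cvg/cvg_ex : cauchy ((fun T => p T x) @ F).
      by move=> [l pl]; exists l.
    apply/cauchy_nrmP => e e0.
    have x0 : 0 < nrm x + 1 by rewrite ltr_wpDl ?nrm_ge0.
    have [A FA AS] := Fe _ (divr_gt0 e0 x0).
    exists ((fun T => p T x) @` A).
      by apply: (@filterS _ F _ A) => // T AT; exists T.
    move=> _ _ [T AT <-] [S BS <-].
    rewrite (le_lt_trans (pB _ _ _)) //.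
    have := AS _ _ AT BS; rewrite ltr_pdivlMr //; apply: le_lt_trans.
    by rewrite ler_wpM2l ?nrm_ge0 // lerDl.
  exists (fun x => projT1 (cid (px x))) => e e0.
  have [A FA AS] := Fe _ e0; apply: (filterS _ (FA)) => T AT x.
  case: (cid (px x)) => l /= /cvg_nrmP pl.
  apply/ler_addgt0Pr => d d0; have := pl _ d0.
  move=> /(filterI FA) /filter_ex [S [AS' Sl]].
  rewrite -(subrKA (p S x)) (le_trans (nrmD _ _)) // addrC lerD ?(ltW Sl) //.
  rewrite (le_trans (pB _ _ _)) // ler_wpM2r ?nrm_ge0 //.
  by rewrite ltW // AS.
have [L Lap] : exists L : H -> H, forall e, 0 < e -> \forall T \near F,
    forall x, nrm (L x - (T : boundedOp H) x) <= e * nrm x.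
  by apply: (lim_ex (fun T => T)) => T S x; rewrite -bop_subE nrm_bopP.
have [L' L'ap] : exists L' : H -> H, forall e, 0 < e -> \forall T \near F,
    forall x, nrm (L' x - star (T : boundedOp H) x) <= e * nrm x.
  apply: (lim_ex (fun T => star T)) => T S x.
  rewrite -bop_subE -starB (le_trans (nrm_bopP _ _)) //.
  by rewrite ler_wpM2r ?nrm_ge0 // nrm_bop_star_le.
have LL' x y : hdot (L x) y = hdot x (L' y).
  apply/eqP; rewrite -subr_eq0; apply/eqP.
  apply: (@nrm_small_scaled _ R[i] _ (2 * nrm x * nrm y)) => e e0.
  have [T [/(_ x) LT /(_ y) L'T]] := filter_ex (filterI (Lap e e0) (L'ap e e0)).
  have -> : hdot (L x) y - hdot x (L' y) =
      hdot (L x - T x) y - hdot x (L' y - star T y) :> R[i].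
    by rewrite hdotDl hdotDr hdotNl hdotNr bop_starE; ring.
  rewrite (le_trans (nrmD _ _)) // nrmN.
  have A := cauchy_schwarz (L x - T x) y.
  have B := cauchy_schwarz x (L' y - star T y).
  have A' : nrm (L x - T x) * nrm y <= e * nrm x * nrm y.
    by rewrite ler_wpM2r ?nrm_ge0.
  have B' : nrm x * nrm (L' y - star T y) <= nrm x * (e * nrm y).
    by rewrite ler_wpM2l ?nrm_ge0.
  have -> : e * (2 * nrm x * nrm y) = e * nrm x * nrm y + nrm x * (e * nrm y).
    by ring.
  exact: lerD (le_trans A A') (le_trans B B').
have L_bop : bounded_adjointable L.
  split; last by exists L'.
    apply: (@adj_linear R H L') => x y.
    by rewrite hdot_conj -LL' -hdot_conj.
  have [T LT] := filter_ex (Lap 1 ltr01).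
  exists (nrm T + 1) => x; rewrite -(subrK (T x) (L x)) (le_trans (nrmD _ _)) //.
  by rewrite mulrDl addrC lerD ?nrm_bopP.
apply/cvg_ex; exists (BoundedOp L_bop).
apply/cvg_nrmP => e e0.
have e20 : 0 < e / 2 by rewrite divr_gt0.
apply: filterS (Lap _ e20) => T LT.
apply: (@le_lt_trans _ _ (e / 2)); last by rewrite ltr_pdivrMr // ltr_pMr // ltrDl.
apply: nrm_bop_le => [|x]; first exact: ltW.
by rewrite bop_subE LT.
Qed.

HB.instance Definition _ := Uniform_isComplete.Build (boundedOp H) bop_complete.

Fact bop_cstar_normM T S : `|T *a S| <= `|T| * `|S|.
Proof. by rewrite !nrmE -rmorphM lecR nrm_bop_mul. Qed.
Fact bop_cstar_norm T : `|star T *a T| = `|T| ^+ 2.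
Proof. by rewrite !nrmE nrm_bop_star_mul rmorphXn. Qed.

HB.instance Definition _ := StarAlgebra_isCStar.Build R (boundedOp H)
  bop_cstar_normM bop_cstar_norm.

End BopStar.

(** * Representations and irreducibility *)

Section RepresentationTheory.
Variables (R : realType) (A : starAlgType R) (H : hilbertType R).
Variables (pi : A -> H -> H) (piP : representation pi).
Implicit Types (a b c : A) (v x y : H).

Lemma rep_lin x : linear (fun a => pi a x).
Proof. by move=> c a b; exact: rep_linear piP c a b x. Qed.

Lemma rep_op_lin a : linear (pi a). Proof. exact: rep_op_linear piP a. Qed.

Lemma rep_hdot a x y : hdot (pi a x) y = hdot x (pi (star a) y).
Proof. by rewrite -(rep_star piP) starK. Qed.

Lemma rep_sqr_nrm a v :
  hdot (pi (star a *a a) v) v = (nrm (pi a v) ^+ 2)%:C.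
Proof. by rewrite (rep_mul piP) (rep_star piP) hdotxx. Qed.

(** The hypothesis exhibits [c^2 - a^* a] as a positive element [b^* b]. Hence
    [|pi a v|^2 + |pi b v|^2 = c^2 <pi 1 v, v>], and [pi 1] is a projection. *)
Lemma rep_bound a b (c : R) v : 0 <= c ->
  star a *a a + star b *a b = (c ^+ 2)%:C *: aone ->
  nrm (pi a v) <= c * nrm v.
Proof.
move=> c0 ab.
have P1 : nrm (pi aone v) <= nrm v.
  have [->|/eqP/nrm_gt0 v0] := eqVneq (pi aone v) 0; first by rewrite nrm0 nrm_ge0.
  rewrite -(ler_pM2l v0) -expr2.
  have -> : nrm (pi aone v) ^+ 2 = nrm (hdot (pi aone v) v : R[i]).
    rewrite -{2}(amul1l (aone : A)) -{2}(star1 A) rep_sqr_nrm nrmcR ger0_norm //.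
    exact: sqr_ge0.
  exact: cauchy_schwarz.
have : (nrm (pi a v) ^+ 2 + nrm (pi b v) ^+ 2)%:C =
    (c ^+ 2 * nrm (pi aone v) ^+ 2)%:C :> R[i].
  rewrite rmorphD [RHS]rmorphM /= -!rep_sqr_nrm star1 amul1l -hdotDl.
  by rewrite -(linD (rep_lin v)) ab (linZ (rep_lin v)) hdotZl.
move=> /complexI E.
rewrite -ler_sqr ?nnegrE ?mulr_ge0 ?nrm_ge0 // exprMn.
apply: (@le_trans _ _ (c ^+ 2 * nrm (pi aone v) ^+ 2)).
  by rewrite -E lerDl sqr_ge0.
by rewrite ler_wpM2l ?sqr_ge0 // ler_sqr ?nnegrE ?nrm_ge0.
Qed.

End RepresentationTheory.

(** Automatic continuity: for [c > |a|] the element [1 - a^* a / c^2] has a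
    self-adjoint square root, so [c^2 - a^* a] is positive. *)
Lemma rep_norm (R : realType) (A : cstarType R) (H : hilbertType R)
    (pi : A -> H -> H) : representation pi ->
  forall a v, nrm (pi a v) <= nrm a * nrm v.
Proof.
move=> piP a v.
have bnd c : nrm a < c -> nrm (pi a v) <= c * nrm v.
  move=> ac; have c0 : 0 < c by exact: le_lt_trans (nrm_ge0 a) ac.
  have c2 : 0 < c ^+ 2 by rewrite exprn_gt0.
  pose h := ((c ^+ 2)^-1)%:C *: (star a *a a).
  have hs : star h = h by rewrite /h starZ conj_real starM starK.
  have hE : nrm h = nrm a ^+ 2 / c ^+ 2.
    by rewrite /h nrmZ nrmcR nrm_star_amul gtr0_norm ?invr_gt0 // mulrC.
  have h1 : nrm h < 1.
    by rewrite hE ltr_pdivrMr // mul1r ltr_pXn2r // nnegrE ?nrm_ge0 // ltW.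
  have [d ds dd] := cstar_sqrt hs (lexx _) h1.
  apply: (@rep_bound _ _ _ _ piP a (c%:C *: d)); first exact: ltW.
  rewrite starZ ds conj_real amulZl amulZr scalerA dd -rmorphM -expr2.
  rewrite scalerBr /h scalerA -rmorphM /= divff ?gt_eqF // scale1r.
  by rewrite addrC subrK.
apply/ler_addgt0Pr => e e0.
have v1 : 0 < nrm v + 1 by rewrite ltr_wpDl ?nrm_ge0.
have e1 : 0 < e / (nrm v + 1) by rewrite divr_gt0.
apply: (le_trans (bnd (nrm a + e / (nrm v + 1)) _)); first by rewrite ltrDl.
rewrite mulrDl lerD2l mulrAC ler_pdivrMr // ler_wpM2l ?(ltW e0) //.
by rewrite lerDl.
Qed.

Lemma closed_fun_eq (T : topologicalType) (R : realType)
    (V : normedModType R[i]) (f g : T -> V) :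
  continuous f -> continuous g -> closed [set x | f x = g x].
Proof.
move=> cf cg.
have -> : [set x | f x = g x] = (fun x => f x - g x) @^-1` [set 0].
  apply/seteqP; split=> x /=; first by move=> ->; rewrite subrr.
  by move/eqP; rewrite subr_eq0 => /eqP.
apply: preimage_closed => [x _|].
  by apply: (@continuousB _ _ _ f g); [exact: cf|exact: cg].
apply/closed_nrmP => x xe; apply: nrm_small => e e0.
by have [y ->] := xe e e0; rewrite subr0 => /ltW.
Qed.

Section Irreducible.
Variables (R : realType) (A : starAlgType R) (H : hilbertType R).
Variables (pi : A -> H -> H) (pi_irr : irreducible pi).

Let piP : representation pi. Proof. by case: pi_irr. Qed.

Lemma irr_exists_nonzero : exists x : H, x <> 0.
Proof. by case: pi_irr => _ [a [x ax]] _; exists (pi a x). Qed.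

Lemma irr_full (S : set H) x : closed S -> linear_subspace S ->
  (forall a y, S y -> S (pi a y)) -> S x -> x <> 0 -> forall y, S y.
Proof.
move=> cS lS iS Sx x0 y; case: pi_irr => _ _ /(_ S cS lS iS) [S0|->//].
by move: Sx; rewrite S0.
Qed.

Lemma irr_unital x : pi aone x = x.
Proof.
case: pi_irr => _ [a [z az0]] _.
apply: (@irr_full [set y | pi aone y = y] (pi a z)) => //.
- by apply: closed_fun_eq; [exact: rep_op_bounded piP _ | move=> y; exact: cvg_id].
- split => [|c u v /= u1 v1]; first exact: lin0 (rep_op_lin piP _).
  by rewrite (rep_op_lin piP) u1 v1.
- by move=> b y /= _; rewrite -(rep_mul piP) amul1l.
- by rewrite /= -(rep_mul piP) amul1l.
Qed.

(** The kernel of [pi z] is an invariant closed subspace because [z] is central,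
    and it contains the range of [pi c]. This is what Schur's lemma is used for
    below, without a spectral theorem. *)
Lemma irr_central_prime c z : (forall a, z *a a = a *a z) -> z *a c = 0 ->
  (forall x, pi c x = 0) \/ (forall x, pi z x = 0).
Proof.
move=> zC zc; have [c0|/existsNP[x cx]] := pselect (forall x, pi c x = 0); first by left.
right; apply: (@irr_full [set y | pi z y = 0] (pi c x)) => //.
- apply: closed_fun_eq; first exact: rep_op_bounded piP _.
  exact: cst_continuous.
- split => [|b u v /= u1 v1]; first exact: lin0 (rep_op_lin piP _).
  by rewrite (rep_op_lin piP) u1 v1 scaler0 addr0.
- move=> b y /= zy.
  by rewrite -(rep_mul piP) zC (rep_mul piP) zy (lin0 (rep_op_lin piP _)).
- by rewrite /= -(rep_mul piP) zc (lin0 (rep_lin piP _)).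
Qed.

End Irreducible.

Lemma star_hom_comp (R : realType) (A B C : starAlgType R) (f : A -> B)
    (g : B -> C) : star_hom f -> star_hom g -> star_hom (fun x => g (f x)).
Proof.
move=> [fl f1 fm fs] [gl g1 gm gs]; split.
- by move=> a x y; rewrite fl gl.
- by rewrite f1 g1.
- by move=> x y; rewrite fm gm.
- by move=> x; rewrite fs gs.
Qed.

Lemma rep_comp (R : realType) (D A : starAlgType R) (H : hilbertType R)
    (f : D -> A) (rho : A -> H -> H) : star_hom f -> representation rho ->
  representation (fun a => rho (f a)).
Proof.
move=> [fl f1 fm fs] rhoP; split.
- by move=> a; exact: rep_op_linear rhoP _.
- by move=> a; exact: rep_op_bounded rhoP _.
- by move=> c a b x; rewrite fl (rep_linear rhoP).
- by move=> a b x; rewrite fm (rep_mul rhoP).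
- by move=> a x y; rewrite fs (rep_star rhoP).
Qed.

(** The elements that preserve a given closed subspace together with their
    adjoints form a C*-subalgebra, because [rho] is continuous. So [f] need not
    be shown surjective: it is enough that it reaches generators. *)
Lemma irr_comp (R : realType) (D : starAlgType R) (A : cstarType R)
    (H : hilbertType R) (f : D -> A) (G : set A) (rho : A -> H -> H) :
  star_hom f -> generates G -> G `<=` range f -> irreducible rho ->
  irreducible (fun a => rho (f a)).
Proof.
move=> fP gG Gf rho_irr; have [rhoP [a0 [x0 ax0]] irr] := rho_irr.
have [fl f1 fm fs] := fP.
split; first exact: rep_comp.
  by exists aone, (rho a0 x0); rewrite f1 (irr_unital rho_irr).
move=> S cS lS iS; apply: irr => // a.
pose T := [set a : A | (forall x, S x -> S (rho a x)) /\
                       (forall x, S x -> S (rho (star a) x))].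
suff : T a by case.
suff -> : T = setT by [].
apply: gG; last first.
- move=> _ /Gf [d _ <-]; split=> x Sx; first exact: iS.
  by rewrite -fs; exact: iS.
- have [S0 SL] := lS; split.
  + by split => x; rewrite ?star1 (irr_unital rho_irr).
  + move=> c b d [b1 b2] [d1 d2]; split=> x Sx.
      by rewrite (rep_linear rhoP); apply: SL; [exact: b1|exact: d1].
    rewrite star_semilinear (rep_linear rhoP).
    by apply: SL; [exact: b2|exact: d2].
  + move=> b d [b1 b2] [d1 d2]; split=> x Sx.
      by rewrite (rep_mul rhoP); apply: b1; exact: d1.
    by rewrite starM (rep_mul rhoP); apply: d2; exact: b2.
  + by move=> b [b1 b2]; split => //; rewrite starK.
- apply/closed_nrmP => b bT.
  have key (b' : A) x : S x ->
      (forall e, 0 < e -> exists2 d, S (rho d x) & nrm (b' - d) < e) ->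
      S (rho b' x).
    move=> Sx H'; apply: (closed_nrmP S).1 => // e e0.
    have x1 : 0 < nrm x + 1 by rewrite ltr_wpDl ?nrm_ge0.
    have [d Sd bd] := H' _ (divr_gt0 e0 x1); exists (rho d x) => //.
    rewrite -(linB (rep_lin rhoP x)) (le_lt_trans (rep_norm rhoP _ _)) //.
    move: bd; rewrite ltr_pdivlMr //; apply: le_lt_trans.
    by rewrite ler_wpM2l ?nrm_ge0 // lerDl.
  split=> x Sx; apply: key => // e e0; have [d [d1 d2] bd] := bT e e0.
    by exists d => //; exact: d1.
  by exists (star d); [exact: d2 | rewrite -starB nrm_star].
Qed.

Section Equivalence.
Variable R : realType.
Implicit Types H K : hilbertType R.

Lemma isometry_nrm H K (W : H -> K) :
  (forall x y, hdot (W x) (W y) = hdot x y) -> forall x, nrm (W x) = nrm x.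
Proof.
move=> WU x; apply/eqP; rewrite -(eqrXn2 (n := 2)) ?nrm_ge0 //; apply/eqP.
by apply/(@complexI R); rewrite -!hdotxx WU.
Qed.

(** The elements intertwined by [W] form a C*-subalgebra: it is closed by
    continuity of the representations, and stable under [star] because [W] is
    unitary. *)
Lemma intertwiner_generates (A : cstarType R) (G : set A) H K
    (pi : A -> H -> H) (sigma : A -> K -> K) (W : H -> K) :
  generates G -> representation pi -> representation sigma ->
  (forall x, pi aone x = x) -> (forall x, sigma aone x = x) ->
  linear W -> bijective W -> (forall x y, hdot (W x) (W y) = hdot x y) ->
  (forall a, G a -> forall x, W (pi a x) = sigma a (W x)) ->
  forall a x, W (pi a x) = sigma a (W x).
Proof.
move=> gG piP sP pi1 s1 WL Wb WU WG a.
pose T := [set a : A | forall x, W (pi a x) = sigma a (W x)].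
suff TT : T = setT by have : T a by rewrite TT.
apply: gG => //.
- apply/closed_nrmP => b bT x; apply/eqP; rewrite -subr_eq0; apply/eqP.
  apply: (@nrm_small_scaled _ _ _ (2 * nrm x)) => e e0.
  have [d dT bd] := bT e e0.
  have -> : W (pi b x) - sigma b (W x) =
      W (pi (b - d) x) - sigma (b - d) (W x).
    rewrite (linB (rep_lin piP x)) (linB (rep_lin sP (W x))) (linB WL) dT.
    by rewrite opprB addrA subrK.
  rewrite (le_trans (nrmD _ _)) // nrmN (isometry_nrm WU).
  have := rep_norm piP (b - d) x; have := rep_norm sP (b - d) (W x).
  rewrite (isometry_nrm WU) => A1 A2.
  rewrite mulrA mulr_natr mulr2n mulrDl.
  by rewrite lerD // (le_trans A1, le_trans A2) // ler_wpM2r ?nrm_ge0 // ltW.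
- split.
  + by move=> x /=; rewrite pi1 s1.
  + move=> c b d bT dT x /=.
    by rewrite (rep_linear piP) (rep_linear sP) WL bT dT.
  + by move=> b d bT dT x /=; rewrite (rep_mul piP) (rep_mul sP) bT dT.
  + move=> b bT x /=; have [V VK KV] := Wb; apply: hdot_eq => z.
    rewrite -(KV z) WU (rep_star piP) (rep_star sP) -bT.
    by rewrite WU.
Qed.

Lemma equivalent_irr (A : starAlgType R) H K
    (pi : A -> H -> H) (sigma : A -> K -> K) :
  unitarily_equivalent pi sigma -> irreducible sigma -> irreducible pi.
Proof.
move=> [W [WL [V VK KV] WU Wpi]] [sP [a0 [y0 ay0]] sI].
have WN := isometry_nrm WU.
have VL : linear V.
  by move=> a x y; apply: (can_inj VK); rewrite WL !KV.
have VN x : nrm (V x) = nrm x by rewrite -WN KV.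
have piE a x : pi a x = V (sigma a (W x)) by rewrite -Wpi VK.
split.
- split.
  + by move=> a c x y; rewrite !piE WL (rep_op_lin sP) VL.
  + move=> a x; apply/cvg_nrmP => e e0.
    have sC : continuous (sigma a) by exact: rep_op_bounded sP _.
    have /cvg_nrmP/(_ _ e0) := sC (W x).
    rewrite !near_simpl => /nbhs_ballP[d /= d0 dP].
    apply/nbhs_ballP; exists d => // y; rewrite -ball_normE /= => xy.
    rewrite !piE -(linB VL) VN; apply: dP; rewrite -ball_normE /=.
    by rewrite -(linB WL) nrmE WN -nrmE.
  + by move=> c a b x; rewrite !piE (rep_linear sP) VL.
  + by move=> a b x; rewrite !piE KV (rep_mul sP).
  + by move=> a x y; rewrite -!WU !piE !KV (rep_star sP).
- exists a0, (V y0); rewrite piE KV => E.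
  by apply: ay0; rewrite -[LHS]KV E (lin0 WL).
- move=> S cS lS iS.
  have : V @^-1` S = [set 0] \/ V @^-1` S = setT.
    apply: sI.
    + apply/closed_nrmP => x xS; apply: (closed_nrmP S).1 => // e e0.
      have [y Sy xy] := xS e e0; exists (V y) => //.
      by rewrite -(linB VL) VN.
    + case: lS => S0 SL; split; first by rewrite /preimage /= (lin0 VL).
      by move=> c x y Sx Sy; rewrite /preimage /= VL; exact: SL.
    + by move=> a x Sx; have := iS a _ Sx; rewrite piE KV.
  case=> E; [left|right]; apply/seteqP; split => x //=.
  + move=> Sx; have : (V @^-1` S) (W x) by rewrite /preimage /= VK.
    by rewrite E /= => Wx; rewrite -(VK x) Wx (lin0 VL).
  + by move=> ->; case: lS.
  + by move=> _; have : (V @^-1` S) (W x); [by rewrite E | by rewrite /preimage /= VK].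
Qed.

End Equivalence.

(** * Representations of algebras of continuous functions *)

Section ComplexContinuity.
Variable R : realType.
Local Notation C := R[i].

Lemma nrm_continuous (V : normedModType R[i]) : continuous (@nrm R V).
Proof.
move=> x; apply/(@cvgrPdist_lt _ R) => e e0.
apply: filterS (nbhs_nrm x e0) => y /= xy.
exact: le_lt_trans (nrm_dist_le _ _) xy.
Qed.

Lemma realC_continuous : continuous (fun a : R => a%:C : C).
Proof.
move=> a; apply/cvg_nrmP => e e0.
have := nbhsx_ballx a e e0; apply: filterS => b; rewrite -ball_normE /= => ab.
by rewrite -[_ - _]/((a%:C - b%:C)) -rmorphB nrmcR.
Qed.

(** Soft thresholding, a perturbation of the identity of size [e] that vanishes
    around [0]: composed with a function, it turns a zero into a neighborhood
    of zeros. *)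
Definition soft (e : R) (z : C) : C := z * (1 - e / Num.max (nrm z) e)%:C.

(** The partner of [soft e] in a pair of functions whose product is zero. *)
Definition bump (e : R) (z : C) : C := (Num.max 0 (e - nrm z))%:C.

(** The witness [b] of [rep_bound] for functions bounded by [c]. *)
Definition cosqrt (c : R) (z : C) : C := (Num.sqrt (c ^+ 2 - nrm z ^+ 2))%:C.

Lemma soft0 e z : 0 < e -> nrm z <= e -> soft e z = 0.
Proof.
by move=> e0 ze; rewrite /soft max_r // divff ?gt_eqF // subrr mulr0.
Qed.

Lemma soft_dist e z : 0 < e -> nrm (z - soft e z) <= e.
Proof.
move=> e0; have m0 : 0 < Num.max (nrm z) e by rewrite lt_max e0 orbT.
have -> : z - soft e z = z * (e / Num.max (nrm z) e)%:C.
  by rewrite /soft rmorphB rmorph1; ring.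
rewrite nrmcM nrmcR ger0_norm; last by rewrite divr_ge0 ?ltW.
rewrite mulrA ler_pdivrMr //.
by rewrite mulrC ler_wpM2l ?(ltW e0) // le_max lexx.
Qed.

Lemma bump_soft e z : 0 < e -> bump e z * soft e z = 0.
Proof.
move=> e0; have [ze|ez] := leP (nrm z) e; first by rewrite soft0 ?mulr0.
by rewrite /bump max_l ?mul0r // subr_le0 ltW.
Qed.

Lemma bump00 e : 0 < e -> bump e 0 = e%:C.
Proof. by move=> e0; rewrite /bump nrm0 subr0 max_r // ltW. Qed.

Lemma soft_continuous e : 0 < e -> continuous (soft e).
Proof.
move=> e0 z; apply: (@continuousM R[i] _ (fun z : C => z)); first exact: cvg_id.
apply: (@continuous_comp _ _ _ (fun z : C => 1 - e / Num.max (nrm z) e)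
  (fun a : R => a%:C : C)); last exact: realC_continuous.
apply: (@continuousB _ R^o); first exact: cst_continuous.
apply: (@continuousM R); first exact: cst_continuous.
apply: (@continuousV R); first by rewrite gt_eqF // lt_max e0 orbT.
apply: (@continuous_max R); first exact: nrm_continuous.
exact: cst_continuous.
Qed.

Lemma bump_continuous e : continuous (bump e).
Proof.
move=> z; apply: (@continuous_comp _ _ _ (fun z : C => Num.max 0 (e - nrm z))
  (fun a : R => a%:C : C)); last exact: realC_continuous.
apply: (@continuous_max R); first exact: cst_continuous.
apply: (@continuousB _ R^o); first exact: cst_continuous.
exact: nrm_continuous.
Qed.

Lemma cosqrt_continuous c : continuous (cosqrt c).
Proof.
move=> z; apply: (@continuous_comp _ _ _
  (fun z : C => Num.sqrt (c ^+ 2 - nrm z ^+ 2))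
  (fun a : R => a%:C : C)); last exact: realC_continuous.
apply: (@continuous_comp _ _ _ (fun z : C => c ^+ 2 - nrm z ^+ 2)); last first.
  exact: sqrt_continuous.
apply: (@continuousB _ R^o); first exact: cst_continuous.
apply: (@continuousM R); exact: nrm_continuous.
Qed.

End ComplexContinuity.

Section FunctionAlgebra.
Variables (R : realType) (X : topologicalType).
Local Notation C := R[i].
Implicit Types (f g : CX R X) (x : X).

Lemma CXDE f g x : (f + g) x = f x + g x. Proof. by []. Qed.
Lemma CXNE f x : (- f) x = - f x. Proof. by []. Qed.
Lemma CXZE (a : C) f x : (a *: f) x = a * f x. Proof. by []. Qed.
Lemma CXME f g x : (f *a g) x = f x * g x. Proof. by []. Qed.
Lemma CXSE f x : (star f) x = (f x)^*. Proof. by []. Qed.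
Lemma CX1E x : (aone : CX R X) x = 1. Proof. by []. Qed.
Lemma CX0E x : (0 : CX R X) x = 0. Proof. by []. Qed.

Lemma CXC f g : f *a g = g *a f.
Proof. by apply: CXP => x; rewrite !CXME mulrC. Qed.

Definition CX_post (h : C -> C) (hC : continuous h) (f : CX R X) : CX R X :=
  CX_comp (mkCX hC) f.

Lemma CX_postE (h : C -> C) (hC : continuous h) f x : CX_post hC f x = h (f x).
Proof. by []. Qed.

Variables (H : hilbertType R) (sigma : CX R X -> H -> H).
Hypothesis sigmaP : representation sigma.

Lemma CX_rep_bound f (c : R) v : 0 <= c -> (forall x, nrm (f x : C) <= c) ->
  nrm (sigma f v) <= c * nrm v.
Proof.
move=> c0 fc.
apply: (rep_bound sigmaP v (b := CX_post (@cosqrt_continuous R c) f)) => //.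
apply: CXP => x; rewrite CXDE !CXME CXZE CX1E !CXSE CX_postE.
rewrite conj_real -rmorphM /= -expr2 sqr_sqrtr; last first.
  by rewrite subr_ge0 ler_sqr ?nnegrE ?nrm_ge0.
by rewrite mulrC mul_conj -rmorphD /= mulr1 addrC subrK.
Qed.

Lemma CX_rep_approx0 f : (forall e, 0 < e ->
    exists2 g, (forall v, sigma g v = 0) & forall x, nrm (f x - g x : C) <= e) ->
  forall v, sigma f v = 0.
Proof.
move=> fe v; apply: (@nrm_small_scaled _ _ _ (nrm v)) => e e0.
have [g g0 fg] := fe e e0.
have -> : sigma f v = sigma (f - g) v.
  by rewrite (linB (rep_lin sigmaP v)) g0 subr0.
by apply: CX_rep_bound => //; exact: ltW.
Qed.

(** A thresholded copy of [f] vanishes around the zero set of [d], so it is a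
    continuous multiple of [d]; hence [f] is a uniform limit of multiples
    of [d]. *)
Lemma CX_rep_zero_set d f : (forall v, sigma d v = 0) ->
  (forall x, d x = 0 -> f x = 0) -> forall v, sigma f v = 0.
Proof.
move=> d0 df; apply: CX_rep_approx0 => e e0.
pose s := CX_post (soft_continuous e0) f.
pose q x : C := s x / d x.
have qC : continuous q.
  move=> x; have [dx0|dx0] := eqVneq (d x) 0; last first.
    apply: (@continuousM R[i]); first exact: cts_fun.
    by apply: (@continuousV R[i]) => //; exact: cts_fun.
  have q0 : \forall y \near x, q y = 0.
    have fC : continuous (f : X -> C) by move=> y; exact: cts_fun.
    have /cvg_nrmP/(_ e e0) := fC x; apply: filterS => y.
    rewrite (df x dx0) sub0r nrmN => fy.
    by rewrite /q CX_postE soft0 ?mul0r // ltW.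
  apply/cvg_nrmP => d' d'0; apply: filterS q0 => y ->.
  by rewrite /q dx0 invr0 mulr0 subr0 nrm0.
exists s; last by move=> x; rewrite CX_postE soft_dist.
have -> : s = mkCX qC *a d.
  apply: CXP => x; rewrite CXME -[mkCX qC x]/(q x) /q.
  have [dx0|dx0] := eqVneq (d x) 0; last by rewrite divfK.
  by rewrite dx0 mulr0 CX_postE soft0 // df // nrm0 ltW.
by move=> v; rewrite (rep_mul sigmaP) d0 (lin0 (rep_op_lin sigmaP _)).
Qed.

End FunctionAlgebra.

(** The zero sets of the functions [f] with [sigma (f \o p) = 0] form a filter
    base of closed subsets of the compact space [X]; the filter clusters at a
    common zero, whose image is the point that [sigma] evaluates at. If
    [f (p x) = 0], then the product of a bump of [f] and a thresholded [f] is
    zero, while [sigma] does not kill the bump, so it kills the thresholded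
    [f], which is as close to [f] as wanted. *)
Lemma CX_rep_character (R : realType) (X Y : topologicalType)
    (p : continuousType X Y) (H : hilbertType R) (sigma : CX R X -> H -> H) :
  compact [set: X] -> representation sigma ->
  (forall v, sigma aone v = v) -> (exists v : H, v <> 0) ->
  (forall f g : CX R Y, (forall y, f y * g y = 0) ->
     (forall v, sigma (CX_comp f p) v = 0) \/
     (forall v, sigma (CX_comp g p) v = 0)) ->
  exists x, forall (f : CX R Y) v, sigma (CX_comp f p) v = f (p x) *: v.
Proof.
move=> cX sP s1 [v0 v00] prime.
pose I := [set f : CX R Y | forall v, sigma (CX_comp f p) v = 0].
pose Z (f : CX R Y) := [set x : X | f (p x) = 0].
have IM (f g : CX R Y) : I f -> I (g *a f).
  move=> If v; have -> : CX_comp (g *a f) p = CX_comp g p *a CX_comp f p.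
    exact: CXP.
  by rewrite (rep_mul sP) If (lin0 (rep_op_lin sP _)).
have ID (f g : CX R Y) : I f -> I g -> I (f + g).
  move=> If Ig v; have -> : CX_comp (f + g) p = CX_comp f p + CX_comp g p.
    exact: CXP.
  by rewrite (linD (rep_lin sP v)) If Ig addr0.
have I0 : I 0.
  by move=> v; rewrite (_ : CX_comp 0 p = 0) ?(lin0 (rep_lin sP v)) //; exact: CXP.
have Zn f : I f -> exists x, Z f x.
  move=> If; apply: contrapT => /forallNP Zf; apply: v00.
  rewrite -(s1 v0); apply: (CX_rep_zero_set sP If) => x fx0.
  by case: (Zf x).
pose F := filter_from I Z.
have FF : ProperFilter F.
  apply: filter_from_proper => [|f If]; last by have [x] := Zn f If; exists x.
  apply: filter_from_filter; first by exists 0.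
  move=> f g If Ig; exists (star f *a f + star g *a g).
    by apply: ID; exact: IM.
  move=> x; rewrite /Z /= CXDE !CXME !CXSE ![_^* * _]mulrC !mul_conj -rmorphD.
  move=> /complexI/eqP; rewrite paddr_eq0 ?sqr_ge0 // !expf_eq0 /=.
  by move=> /andP[/eqP/nrm0_eq ? /eqP/nrm0_eq].
have [x [_ Fx]] := cX F FF filterT.
have ev0 (f : CX R Y) : I f -> f (p x) = 0.
  move=> If.
  have cZ : closed (Z f).
    apply: (@closed_fun_eq X R R[i] (CX_comp f p) (fun=> 0)).
      by move=> y; exact: cts_fun.
    exact: cst_continuous.
  apply: cZ => B Bx; apply: Fx => //.
  by exists f.
exists x.
have ker (f : CX R Y) v : f (p x) = 0 -> sigma (CX_comp f p) v = 0.
  move=> fx; move: v; apply: (CX_rep_approx0 sP) => e e0.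
  exists (CX_comp (CX_post (soft_continuous e0) f) p); last first.
    by move=> y; exact: (soft_dist (f (p y))).
  have [B|//] := prime (CX_post (@bump_continuous R e) f)
                       (CX_post (soft_continuous e0) f)
                       (fun y => bump_soft (f y) e0).
  have := ev0 _ B; rewrite CX_postE fx bump00 // => /complexI/eqP; rewrite gt_eqF //.
move=> f v; have := ker (f - f (p x) *: aone) v.
rewrite CXDE CXNE CXZE CX1E mulr1 subrr => /(_ erefl).
have -> : CX_comp (f - f (p x) *: aone) p = CX_comp f p - f (p x) *: aone.
  exact: CXP.
rewrite (linB (rep_lin sP v)) (linZ (rep_lin sP v)) s1.
by move/eqP; rewrite subr_eq0 => /eqP.
Qed.

(** * Compactness and extension from circles to the disk *)

Section Compactness.
Variable R : realType.
Local Notation C := R[i].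

Lemma set_type_nbhs (X : topologicalType) (A : set X) (x : A) (U : set A) :
  nbhs x U -> exists V : set X, [/\ open V, V (set_val x) & set_val @^-1` V `<=` U].
Proof. by rewrite nbhsE => -[_ [[V oV <-] Vx] VU]; exists V. Qed.

Lemma set_type_compact (X : topologicalType) (A : set X) :
  compact A -> compact [set: A].
Proof.
move=> cA F FF _.
have FA : (set_val @ F) A.
  by apply: (@filterS _ F _ setT) => [x _|]; [exact: set_valP | exact: filterT].
have [x [Ax Fx]] := cA _ _ FA.
exists (exist _ x (mem_set Ax)); split=> // B U FB /set_type_nbhs[V [oV Vx VU]].
have [] := Fx (set_val @` B) V.
- by apply: (@filterS _ F _ B) => // y By; exists y.
- exact: open_nbhs_nbhs.
- by move=> _ [[y By <-] Vy]; exists y; split => //; exact: VU.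
Qed.

Lemma disk_setE (z : C) : disk_set z <-> nrm z <= 1.
Proof. by rewrite /disk_set /= nrmE -[X in _ <= X]/(1%:C) lecR. Qed.

Lemma circle_setE (r : {i01 R}) (z : C) : circle_set r z <-> nrm z = r%:num.
Proof. by rewrite /circle_set /= nrmE; split=> [/complexI|->]. Qed.

Lemma compact_disk_set : compact (@disk_set R).
Proof.
pose j (ab : R * R) : C := ab.1 +i* ab.2.
have jC : continuous j.
  move=> [a b]; apply/cvg_nrmP => e e0.
  have e2 : 0 < e / 2 by rewrite divr_gt0.
  exists (ball a (e / 2), ball b (e / 2)) => /=; first by split; exact: nbhsx_ballx.
  move=> [c d] /= []; rewrite -!ball_normE /= => ac bd.
  rewrite -ltcR -nrmE (le_lt_trans (normC_le_ReIm _)) // ltcR /=.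
  by rewrite [ltRHS](splitr e) ltrD.
apply: (@subclosed_compact _ _ (j @` (`[-1, 1]%classic `*` `[-1, 1]%classic))).
- apply/closed_nrmP => z zD; apply/disk_setE; apply/ler_addgt0Pr => e e0.
  have [y /disk_setE y1 zy] := zD e e0.
  by rewrite -(subrK y z) (le_trans (nrmD _ _)) // addrC lerD // ltW.
- apply: continuous_compact; first exact: continuous_subspaceT.
  by apply: compact_setX; exact: segment_compact.
- move=> z /disk_setE z1; exists (complex.Re z, complex.Im z); last by case: (z).
  have Re1 : `|complex.Re z| <= 1.
    by rewrite (le_trans _ z1) // -lecR -nrmE normC_Re_le.
  have Im1 : `|complex.Im z| <= 1.
    by rewrite (le_trans _ z1) // -lecR -nrmE normC_Im_le.
  by split; rewrite /= in_itv /= -ler_norml.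
Qed.

Lemma compact_disk : compact [set: disk R].
Proof. exact: set_type_compact compact_disk_set. Qed.

Lemma compact_circle r : compact [set: circle (r : {i01 R})].
Proof.
apply: set_type_compact; apply: (subclosed_compact _ compact_disk_set).
  rewrite (_ : circle_set r = [set z : C | `|z| = (r%:num)%:C]) //.
  apply/closed_nrmP => z zD; apply/circle_setE; apply/eqP.
  rewrite -subr_eq0 -normr_eq0; apply/eqP.
  apply/eqP; rewrite eq_le normr_ge0 andbT; apply/ler_addgt0Pr => e e0.
  have [y /circle_setE <- zy] := zD e e0; rewrite add0r (le_trans _ (ltW zy)) //.
  exact: nrm_dist_le.
by move=> z /circle_setE zr; apply/disk_setE; rewrite zr.
Qed.

End Compactness.

Section Extension.
Variable R : realType.
Local Notation C := R[i].

Lemma restrict_circle0 (r : {i01 R}) (f : CX R (circle r)) : r%:num = 0 ->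
  exists g : CX R (disk R), restrict_circle r g = f.
Proof.
move=> r0; have c0P : (0 : C) \in circle_set r.
  by apply/mem_set/circle_setE; rewrite nrm0 r0.
pose c0 : circle r := exist _ 0 c0P.
exists (CX_cst _ (f c0)); apply: CXP => x; rewrite -[LHS]/(f c0); congr (f _).
apply: val_inj; apply/esym/nrm0_eq; rewrite -r0; apply/circle_setE.
exact: set_mem (valP x).
Qed.

(** The extension is [f (r z / |z|)] damped by a radial factor that is 1 on the
    circle and vanishes for [|z| <= r / 2], hence near the origin. *)
Lemma restrict_circle_pos (r : {i01 R}) (f : CX R (circle r)) : 0 < r%:num ->
  exists g : CX R (disk R), restrict_circle r g = f.
Proof.
move=> r0; set s := r%:num in r0.
pose q (z : C) : C := z * (s / nrm z)%:C.
have nq (z : C) : z != 0 -> q z \in circle_set r.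
  move=> /eqP/nrm_gt0 z0; apply/mem_set/circle_setE; rewrite nrmcM nrmcR.
  by rewrite ger0_norm ?divr_ge0 ?ltW // mulrC divfK // gt_eqF.
have srP : (s%:C : C) \in circle_set r.
  by apply/mem_set/circle_setE; rewrite nrmcR ger0_norm // ltW.
pose sr : circle r := exist (fun z : C => z \in circle_set r) _ srP.
pose p (z : disk R) : circle r := insubd sr (q (set_val z)).
have pE (z : disk R) : set_val z != 0 -> set_val (p z) = q (set_val z).
  by move=> z0; rewrite /p; apply: insubdK; exact: nq.
have p_cont (z : disk R) : set_val z != 0 -> {for z, continuous p}.
  move=> z0 U /set_type_nbhs[V [oV Vp VU]].
  have qC : {for set_val z, continuous q}.
    apply: (@continuousM R[i] _ (fun z : C => z)); first exact: cvg_id.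
    apply: (@continuous_comp _ _ _ (fun z : C => s / nrm z) (fun a : R => a%:C : C)).
      apply: (@continuousM R); first exact: cst_continuous.
      apply: (@continuousV R); last exact: nrm_continuous.
      by rewrite gt_eqF //; apply: nrm_gt0; apply/eqP.
    exact: realC_continuous.
  have n0 : \forall y \near (set_val z : C), y != 0.
    have nz : 0 < nrm (set_val z : C) by apply: nrm_gt0; apply/eqP.
    apply: filterS (nbhs_nrm (set_val z : C) nz) => y /= zy.
    by apply: contraTneq zy => ->; rewrite subr0 ltxx.
  have Vq : \forall y \near (set_val z : C), V (q y).
    have Vz : V (q (set_val z)) by rewrite -pE.
    exact: (qC V (open_nbhs_nbhs (conj oV Vz))).
  have zN : \forall y \near z, set_val y != 0 /\ V (q (set_val y)).
    have nV : nbhs (set_val z : C) [set w : C | w != 0 /\ V (q w)].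
      by apply: filterS2 n0 Vq.
    by move/(@initial_continuous (disk R) C set_val z): nV.
  apply: (@filterS _ (nbhs z) _ _ (p @^-1` U) _ zN) => y [y0 Vy].
  by apply: VU; rewrite /preimage /= pE.
pose chi (z : disk R) : C := (Num.max 0 (2 / s * nrm (set_val z : C) - 1))%:C.
have chi_cont : continuous chi.
  move=> z; apply: (@continuous_comp _ _ _
    (fun z : disk R => Num.max 0 (2 / s * nrm (set_val z : C) - 1))
    (fun a : R => a%:C : C)); last exact: realC_continuous.
  apply: (@continuous_max R); first exact: cst_continuous.
  apply: (@continuousB _ R^o); last exact: cst_continuous.
  apply: (@continuousM R); first exact: cst_continuous.
  apply: (@continuous_comp _ _ _ (fun z : disk R => set_val z : C) (@nrm R C)).
    exact: initial_continuous.
  exact: nrm_continuous.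
pose g (z : disk R) : C := chi z * f (p z).
have gC : continuous g.
  move=> z; have [z0|z0] := eqVneq (set_val z : C) 0; last first.
    apply: (@continuousM R[i]); first exact: chi_cont.
    by apply: continuous_comp; [exact: p_cont | exact: cts_fun].
  have g0 : \forall y \near z, g y = 0.
    have s2 : 0 < s / 2 by rewrite divr_gt0.
    have zN : \forall y \near z, nrm (set_val z - set_val y : C) < s / 2.
      have sN := nbhs_nrm (set_val z : C) s2.
      by move/(@initial_continuous (disk R) C set_val z): sN.
    apply: (filterS _ zN) => y; rewrite z0 sub0r nrmN => ys.
    rewrite /g /chi max_l ?mul0r // subr_le0.
    by rewrite mulrAC ler_pdivrMr // mul1r -ler_pdivlMl // mulrC ltW.
  apply/(@cvg_nrmP R C (disk R) (nbhs z)) => e e0; apply: filterS g0 => y ->.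
  by rewrite subr0 /g /chi z0 nrm0 mulr0 sub0r max_l ?mul0r ?nrm0 //.
exists (mkCX gC); apply: CXP => x.
rewrite -[LHS]/(g (circle_disk x)) /g.
have xr : nrm (set_val x : C) = s by apply/circle_setE; exact: set_mem (valP x).
have -> : chi (circle_disk x) = 1.
  by rewrite /chi /= xr divfK ?gt_eqF // max_r; [congr (_%:C); lra | lra].
rewrite mul1r; congr (f _); apply: val_inj.
rewrite -[LHS]/(set_val (p (circle_disk x))) pE /=.
  by rewrite /q xr divff ?gt_eqF // mulr1.
by apply: contraTneq r0 => x0; rewrite -xr [set_val x]x0 nrm0 ltxx.
Qed.

Lemma restrict_circle_surj (r : {i01 R}) (f : CX R (circle r)) :
  exists g : CX R (disk R), restrict_circle r g = f.
Proof.
have : 0 <= r%:num by [].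
rewrite le_eqVlt => /orP[/eqP r0|]; last exact: restrict_circle_pos.
exact: restrict_circle0.
Qed.

End Extension.

(** * Irreducible representations of the disk crossed product *)

Section OperatorRepresentation.
Variables (R : realType) (H : hilbertType R).

Fact rep_bop_subproof (A : cstarType R) (pi : A -> H -> H)
  (piP : representation pi) a : bounded_adjointable (pi a).
Proof.
split; first exact: rep_op_lin.
- by exists (nrm a) => x; exact: rep_norm.
- by exists (pi (star a)) => x y; exact: rep_hdot.
Qed.
Definition rep_bop (A : cstarType R) (pi : A -> H -> H)
  (piP : representation pi) a : boundedOp H := BoundedOp (rep_bop_subproof piP a).

Lemma bop_rep (A : starAlgType R) (psi : A -> boundedOp H) : star_hom psi ->
  representation (fun a x => psi a x).
Proof.
move=> [pl p1 pm ps]; split.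
- by move=> a; exact: bop_lin.
- move=> a x; apply/cvg_nrmP => e e0.
  have n0 : 0 < nrm (psi a) + 1 by rewrite ltr_wpDl ?nrm_ge0.
  apply: filterS (nbhs_nrm x (divr_gt0 e0 n0)) => y /= xy.
  rewrite -(linB (@bop_lin _ _ (psi a))) (le_lt_trans (nrm_bopP _ _)) //.
  move: xy; rewrite ltr_pdivlMr //; apply: le_lt_trans.
  by rewrite mulrC ler_wpM2l ?nrm_ge0 // lerDl.
- by move=> c a b x; rewrite pl.
- by move=> a b x; rewrite pm.
- by move=> a x y; rewrite ps bop_starE starK.
Qed.

End OperatorRepresentation.

Section DiskCrossedProduct.
Variables (R : realType) (theta : R) (CD : crossedProduct R (disk_rotation theta)).
Variables (H : hilbertType R).
Local Notation C := R[i].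

Lemma cp_incl_rep (X : topologicalType) (phi : homeomorphism X)
    (D : crossedProduct R phi) (pi : D -> H -> H) :
  representation pi -> representation (fun f => pi (cp_incl D f)).
Proof. exact: rep_comp (cp_incl_hom D). Qed.

Lemma restrict_circle_comp (r : {i01 R}) (g : CX R (disk R)) :
  restrict_circle r (CX_comp g (disk_rotation theta)) =
  CX_comp (restrict_circle r g) (circle_rotation r theta).
Proof. by apply: CXP => x; congr (g _); exact: val_inj. Qed.

(** A function on the circle acts through [pi g] for any extension [g] to the
    disk, the choice being immaterial by the last hypothesis. Universality of
    the crossed product of the circle, with values in the bounded operators,
    then yields the factorization. *)
Lemma disk_rep_factor (r : {i01 R}) (G : crossedProduct R (circle_rotation r theta))
    (xi : CD -> G) (pi : CD -> H -> H) :
  restriction_map xi -> representation pi -> (forall v, pi aone v = v) ->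
  (forall g : CX R (disk R), restrict_circle r g = 0 ->
     forall v, pi (cp_incl CD g) v = 0) ->
  exists2 rho : G -> H -> H, representation rho
    & forall a v, pi a v = rho (xi a) v.
Proof.
move=> [xiH xiI xiU] piP pi1 pi0.
have [iL i1 iM iS] := cp_incl_hom CD.
have piPi := cp_incl_rep piP.
pose ext f := projT1 (cid (restrict_circle_surj (r := r) f)).
have extP f : restrict_circle r (ext f) = f.
  by rewrite /ext; case: (cid _).
pose k f : boundedOp H := rep_bop piP (cp_incl CD (ext f)).
have kE g v : k (restrict_circle r g) v = pi (cp_incl CD g) v.
  apply/eqP; rewrite -subr_eq0; apply/eqP.
  rewrite -[LHS](linB (rep_lin piPi v)); apply: pi0.
  rewrite [LHS](_ : _ = restrict_circle r (ext (restrict_circle r g)) -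
                        restrict_circle r g); last exact: CXP.
  by rewrite extP subrr.
have kH : star_hom k.
  split.
  - move=> a f g; apply: bop_ext => v.
    rewrite -[in LHS](extP f) -[in LHS](extP g).
    rewrite (_ : _ + _ = restrict_circle r (a *: ext f + ext g)); last exact: CXP.
    by rewrite kE iL (rep_linear piP).
  - apply: bop_ext => v.
    rewrite (_ : aone = restrict_circle r aone); last exact: CXP.
    by rewrite kE i1 pi1.
  - move=> f g; apply: bop_ext => v.
    rewrite -[in LHS](extP f) -[in LHS](extP g).
    rewrite (_ : _ *a _ = restrict_circle r (ext f *a ext g)); last exact: CXP.
    by rewrite kE iM (rep_mul piP).
  - move=> f; apply: bop_ext => v.
    rewrite -[in LHS](extP f).
    rewrite (_ : star _ = restrict_circle r (star (ext f))); last exact: CXP.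
    rewrite kE iS; apply: hdot_eq => w.
    by rewrite (rep_star piP) [RHS]bop_starE starK.
have sE a v : (star (rep_bop piP a)) v = pi (star a) v.
  by apply: hdot_eq => w; rewrite (rep_star piP) [LHS]bop_starE starK.
have [u1 u2] := cp_unitary CD.
have uU : unitary (rep_bop piP (cp_unit CD)).
  split; apply: bop_ext => v.
    rewrite -[LHS]/(star (rep_bop piP (cp_unit CD)) (pi (cp_unit CD) v)).
    by rewrite sE -(rep_mul piP) u1 pi1.
  rewrite -[LHS]/(pi (cp_unit CD) (star (rep_bop piP (cp_unit CD)) v)).
  by rewrite sE -(rep_mul piP) u2 pi1.
have cov : covariant (circle_rotation r theta) k (rep_bop piP (cp_unit CD)).
  move=> f; apply: bop_ext => v.
  rewrite -[LHS]/(star (rep_bop piP (cp_unit CD)) (k f (pi (cp_unit CD) v))).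
  rewrite sE -{1}(extP f) kE -!(rep_mul piP) cp_covariant.
  by rewrite -kE restrict_circle_comp extP.
have [psi [psiH psiI psiU]] := cp_universal G kH uU cov.
exists (fun a x => psi a x); first exact: bop_rep.
have rhoP := bop_rep (star_hom_comp xiH psiH).
have [_ psi1 _ _] := psiH; have [_ xi1 _ _] := xiH.
move=> a v; refine (@intertwiner_generates R CD _ H H pi
  (fun a x => psi (xi a) x) id (@cp_generates _ _ _ CD) piP rhoP pi1 _ _ _ _ _ a v) => //.
- by move=> x; rewrite xi1 psi1.
- by exists id.
- by move=> _ [[g _ <-]|->] x /=; [rewrite xiI psiI kE | rewrite xiU psiU].
Qed.

(** The radial functions are invariant under the rotation, hence central. *)
Lemma radial_central (g : CX R (disk R)) :
  (forall z w : disk R, `|set_val z : C| = `|set_val w| -> g z = g w) ->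
  forall a, cp_incl CD g *a a = a *a cp_incl CD g.
Proof.
move=> gr a; have [iL i1 iM iS] := cp_incl_hom CD.
have [u1 u2] := cp_unitary CD; set U := cp_unit CD in u1 u2.
set c := cp_incl CD g.
pose T := [set a : CD | c *a a = a *a c /\ c *a star a = star a *a c].
suff TT : T = setT by have [] : T a by rewrite TT.
apply: (@cp_generates _ _ _ CD).
- apply/closed_nrmP => b bT.
  have key (b' : CD) :
      (forall e, 0 < e -> exists2 d, c *a d = d *a c & nrm (b' - d) < e) ->
      c *a b' = b' *a c.
    move=> H'; apply/eqP; rewrite -subr_eq0; apply/eqP.
    apply: (@nrm_small_scaled _ _ _ (2 * nrm c)) => e e0.
    have [d dc bd] := H' _ e0.
    have -> : c *a b' - b' *a c = c *a (b' - d) - (b' - d) *a c.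
      by rewrite amulBl amulBr dc opprB addrA subrK.
    rewrite (le_trans (nrmD _ _)) // nrmN.
    have A1 := nrm_amul c (b' - d); have A2 := nrm_amul (b' - d) c.
    have A3 : nrm c * nrm (b' - d) <= nrm c * e.
      by rewrite ler_wpM2l ?nrm_ge0 // ltW.
    have A4 : nrm (b' - d) * nrm c <= nrm c * e by rewrite mulrC.
    rewrite [leRHS](_ : _ = nrm c * e + nrm c * e); last by ring.
    by rewrite lerD // (le_trans A1, le_trans A2).
  split; apply: key => e e0; have [d [d1 d2] bd] := bT e e0.
    by exists d.
  by exists (star d) => //; rewrite -starB nrm_star.
- split.
  + by rewrite /T /= star1 amul1l amul1r.
  + move=> s x y [x1 x2] [y1 y2]; rewrite /T /= star_semilinear.
    by rewrite !(amul_linearl, amul_linearr) x1 x2 y1 y2.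
  + move=> x y [x1 x2] [y1 y2]; rewrite /T /= starM.
    by rewrite !amulA x1 y2 -!amulA y1 x2.
  + by move=> x [x1 x2]; rewrite /T /= starK.
- move=> _ [[f _ <-]|->].
    by rewrite /T /= -iS -!iM; split; congr (cp_incl CD _); exact: CXC.
  have cc : star U *a c *a U = c.
    rewrite cp_covariant; congr (cp_incl CD _); apply: CXP => z.
    by apply: gr; rewrite /= normrM norm_expi mul1r.
  split.
    by rewrite -{2}cc !amulA u2 amul1l.
  by rewrite -{1}cc -!amulA u2 amul1r.
Qed.

Lemma disk_norm_continuous :
  continuous (fun z : disk R => (nrm (set_val z : C))%:C : C).
Proof.
move=> z; apply: (@continuous_comp _ _ _ (fun z : disk R => nrm (set_val z : C))
  (fun a : R => a%:C : C)); last exact: realC_continuous.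
apply: (@continuous_comp _ _ _ (fun z : disk R => set_val z : C) (@nrm R C)).
  exact: initial_continuous.
exact: nrm_continuous.
Qed.

(** Radial functions are central, so [pi] restricted to them is a character,
    the evaluation at some radius [r]. In particular [pi] kills the function
    [|z| - r], whose zero set is the circle of radius [r]. *)
Lemma irr_radius (pi : CD -> H -> H) : irreducible pi ->
  exists r : {i01 R}, forall g : CX R (disk R), restrict_circle r g = 0 ->
     forall v, pi (cp_incl CD g) v = 0.
Proof.
move=> pi_irr; have [piP _ _] := pi_irr.
have piPi := cp_incl_rep piP; have [iL i1 iM iS] := cp_incl_hom CD.
pose p : continuousType (disk R) C := mkcts disk_norm_continuous.
have [|||z0 z0P] := @CX_rep_character R (disk R) C p H _ (@compact_disk R) piPi.
- by move=> v; rewrite i1 (irr_unital pi_irr).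
- exact: irr_exists_nonzero pi_irr.
- move=> f g fg; apply: (irr_central_prime pi_irr).
    apply: radial_central => z w zw.
    have pzw : p z = p w.
      apply/(congr1 (real_complex R)).
      exact: (congr1 (@complex.Re R) zw).
    by rewrite -[LHS]/(g (p z)) pzw.
  rewrite -iM (_ : _ *a _ = 0) ?(lin0 iL) //; apply: CXP => z.
  by rewrite CXME mulrC; exact: fg.
have r01 : 0 <= nrm (set_val z0 : C) <= 1.
  by rewrite nrm_ge0; apply/disk_setE; exact: set_mem (valP z0).
pose r : {i01 R} := Itv01 (andP r01).1 (andP r01).2.
exists r => g g0.
pose d0 : CX R C := mkCX (fun z : C => @cvg_id _ (nbhs z)) - CX_cst C (r%:num)%:C.
apply: (CX_rep_zero_set piPi (d := CX_comp d0 p)).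
  move=> v; rewrite z0P /d0 CXDE CXNE.
  rewrite (_ : _ - _ = 0) ?scale0r //; exact: subrr.
move=> z; rewrite -[LHS]/((nrm (set_val z : C))%:C - (r%:num)%:C) => /eqP.
rewrite subr_eq0 => /eqP/complexI zr.
have zc : (set_val z : C) \in circle_set r by apply/mem_set/circle_setE.
pose zr' : circle r := exist (fun w : C => w \in circle_set r) _ zc.
have := congr1 (fun f : CX R (circle r) => f zr') g0.
rewrite CX0E => <-; congr (g _); exact: val_inj.
Qed.

End DiskCrossedProduct.

(** * Commutative irreducible representations *)

Section CommutativeRepresentations.
Variables (R : realType) (X : topologicalType).

Lemma star_iso_inv (A B : starAlgType R) (f : A -> B) : star_iso f ->
  exists2 g : B -> A, star_hom g & cancel f g.
Proof.
move=> [[fl f1 fm fs] [g fK gK]]; exists g => //; split.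
- by move=> a x y; apply: (can_inj fK); rewrite fl !gK.
- by apply: (can_inj fK); rewrite f1 gK.
- by move=> x y; apply: (can_inj fK); rewrite fm !gK.
- by move=> x; apply: (can_inj fK); rewrite fs !gK.
Qed.

Lemma irr_factor (D A : starAlgType R) (H : hilbertType R) (f : D -> A)
    (rho : A -> H -> H) : representation rho ->
  irreducible (fun a => rho (f a)) -> irreducible rho.
Proof.
move=> rhoP [_ [a [x ax]] irr]; split => //; first by exists (f a), x.
by move=> S cS lS iS; apply: irr => // b y; exact: iS.
Qed.

Lemma irr_nu (D : starAlgType R) (f : D -> CX R X) (w : X) : star_hom f ->
  irreducible (fun a : D => nu w (f a)).
Proof.
move=> fH; have [fl f1 fm fs] := fH; split.
- apply: (rep_comp fH); split.
  + move=> g a x y.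
    by rewrite /nu -[a *: x]/(a * x) -[RHS]/(a * (g w * x) + g w * y); ring.
  + move=> g x; apply: (@continuousM R[i] _ (fun=> g w) (fun x => x)).
      exact: cst_continuous.
    exact: cvg_id.
  + move=> a g h x; rewrite /nu CXDE CXZE.
    by rewrite -[RHS]/(a * (g w * x) + h w * x); ring.
  + by move=> g h x; rewrite /nu CXME mulrA.
  + move=> g x y; rewrite /nu CXSE -[LHS]/((g w)^* * x * y^*).
    by rewrite -[RHS]/(x * (g w * y)^*) rmorphM; ring.
- exists aone, 1; rewrite f1 /nu CX1E mulr1; exact/eqP/oner_neq0.
- move=> S cS [S0 SL] _.
  have [[x [Sx x0]]|nS] := pselect (exists x, S x /\ x <> 0).
    right; apply/seteqP; split => // y _.
    have := SL (y / x) x 0 Sx S0; rewrite addr0.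
    by rewrite -[_ *: _]/(y / x * x) divfK //; exact/eqP.
  left; apply/seteqP; split => [x Sx|_ ->//] /=.
  by apply: contrapT => x0; apply: nS; exists x.
Qed.

(** An irreducible representation of a commutative algebra acts by scalars, so
    every line is invariant and the space is a line. *)
Lemma irr_CX_nu (H : hilbertType R) (rho : CX R X -> H -> H) :
  compact [set: X] -> irreducible rho ->
  exists w : X, unitarily_equivalent rho (nu w).
Proof.
move=> cX rho_irr; have [rhoP _ _] := rho_irr.
have [x x0] := irr_exists_nonzero rho_irr.
pose p : continuousType X X := mkcts (fun x : X => @cvg_id _ (nbhs x)).
have [|||w wP] := @CX_rep_character R X X p H rho cX rhoP.
- exact: irr_unital rho_irr.
- by exists x.
- move=> f g fg; apply: (irr_central_prime rho_irr); first exact: CXC.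
  by apply: CXP => y; rewrite CXME mulrC; exact: fg.
exists w.
have rhoE f v : rho f v = f w *: v.
  by rewrite -wP; congr (rho _ v); exact: CXP.
pose n := nrm x; have n0 : 0 < n by exact: nrm_gt0.
have full y : (n ^+ 2)%:C *: y = hdot y x *: x.
  move: y; apply: (irr_full rho_irr (x := x)
    (S := [set y | (n ^+ 2)%:C *: y = hdot y x *: x])) => //.
  - apply/closed_nrmP => y yS; apply/eqP; rewrite -subr_eq0; apply/eqP.
    apply: (@nrm_small_scaled _ _ _ (2 * n ^+ 2)) => e e0.
    have [z zS yz] := yS e e0.
    have -> : (n ^+ 2)%:C *: y - hdot y x *: x =
        (n ^+ 2)%:C *: (y - z) - hdot (y - z) x *: x.
      by rewrite scalerBr hdotDl hdotNl scalerBl zS opprB addrA subrK.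
    rewrite (le_trans (nrmD _ _)) // nrmN !nrmZ nrmcR ger0_norm ?sqr_ge0 //.
    have A1 : n ^+ 2 * nrm (y - z) <= n ^+ 2 * e.
      by rewrite ler_wpM2l ?sqr_ge0 // ltW.
    have A2 : nrm (hdot (y - z) x : R[i]) * nrm x <= nrm (y - z) * n * n.
      by rewrite ler_wpM2r ?nrm_ge0 // cauchy_schwarz.
    have A3 : nrm (y - z) * n * n = n ^+ 2 * nrm (y - z) by ring.
    lra.
  - split; first by rewrite /= scaler0 hdot0l scale0r.
    move=> c y z /= yS zS.
    by rewrite scalerDr scalerA mulrC -scalerA yS zS hdotDl hdotZl scalerDl scalerA.
  - by move=> f y /= yS; rewrite rhoE hdotZl scalerA mulrC -!scalerA yS.
  - by rewrite /= hdotxx.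
pose u := (n^-1)%:C *: x.
have uu : hdot u u = 1.
  rewrite /u hdotZl hdotZr conj_real hdotxx -!rmorphM /=.
  by rewrite (_ : _ * _ = 1) //; field; rewrite gt_eqF.
have uE y : y = hdot y u *: u.
  have n2 : ((n ^+ 2)%:C : R[i]) != 0.
    by apply/eqP => /complexI/eqP; rewrite gt_eqF // exprn_gt0.
  apply: (can_inj (scalerK n2)); rewrite full.
  rewrite /u hdotZr conj_real !scalerA; congr (_ *: _).
  rewrite [RHS](_ : _ = ((n ^+ 2)%:C * (n^-1)%:C * (n^-1)%:C) * hdot y x); last by ring.
  by rewrite -!rmorphM /= (_ : _ / n = 1) ?mul1r //; field; rewrite gt_eqF.
clearbody u.
exists (fun y => hdot y u); split.
- by move=> c y z; rewrite hdotDl hdotZl.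
- exists (fun c : R[i] => c *: u) => [y|c]; first by rewrite -uE.
  by rewrite hdotZl uu mulr1.
- move=> y z; rewrite [in RHS](uE y) [in RHS](uE z) hdotZl hdotZr uu mulr1.
  by [].
- by move=> f y; rewrite rhoE hdotZl.
Qed.

End CommutativeRepresentations.

(** * Classification *)

Theorem proposition5p1 (R : realType) (theta : R) (theta01 : 0 <= theta < 1)
    (CD : crossedProduct R (disk_rotation theta))
    (CG : forall r : {i01 R}, crossedProduct R (circle_rotation r theta))
    (Atheta : rotationAlgebra theta)
    (xi : forall r : {i01 R}, CD -> CG r)
    (xiP : forall r : {i01 R}, restriction_map (xi r))
    (iota : forall r : {i01 R}, CG r -> Atheta)
    (iotaP : forall r : {i01 R}, 0 < r%:num -> rotation_identification (iota r))
    (iota0 : CG 0%:i01 -> CX R (circle (1%:i01 : {i01 R})))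
    (iota0P : torus_identification iota0) :
  (forall (H : hilbertType R) (pi : CD -> H -> H),
     irreducible pi <->
     (exists (r : {i01 R}) (rho : Atheta -> H -> H),
        [/\ 0 < r%:num, irreducible rho
          & pi = fun a : CD => rho (iota r (xi r a))])
     \/ (exists w : circle (1%:i01 : {i01 R}),
           unitarily_equivalent pi
             (fun a : CD => nu w (iota0 (xi 0%:i01 a))))) /\
  (forall (H K : hilbertType R) (r s : {i01 R})
          (rho : CG r -> H -> H) (sigma : CG s -> K -> K),
     irreducible rho -> irreducible sigma ->
     unitarily_equivalent (fun a : CD => rho (xi r a))
                          (fun a : CD => sigma (xi s a)) <->
     exists e : r = s,
       unitarily_equivalent rho (fun a : CG r => sigma (ecast t (CG t) e a))).
Proof.
split.
  move=> H pi; split.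
    move=> pi_irr; have [piP _ _] := pi_irr.
    have pi1 := irr_unital pi_irr.
    have [r /(disk_rep_factor (xiP r) piP pi1)[rho rhoP piE]] := irr_radius pi_irr.
    have rho_irr : irreducible rho.
      apply: (@irr_factor R CD (CG r) H (xi r)) => //.
      by rewrite (_ : (fun a => _) = pi) //; apply/funext => a; apply/funext => v.
    (* The radius 0 gives characters of the torus, the others representations
       of the rotation algebra. *)
    have : 0 <= r%:num by [].
    rewrite le_eqVlt => /orP[/eqP r0|r0].
      have rE : r = 0%:i01 by apply/val_inj.
      subst r.
      right; have [iH _] := iota0P; have [j jH jK] := star_iso_inv iH.
      have : irreducible (fun f => rho (j f)).
        apply: (@irr_factor R (CG 0%:i01) _ H iota0); first exact: rep_comp.
        by rewrite (_ : (fun a => _) = rho) //; apply/funext => a; rewrite jK.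
      move=> /(irr_CX_nu (@compact_circle R _))[w [W [WL Wb WU WE]]].
      exists w; exists W; split => // a x.
      by rewrite piE -WE jK.
    left; have [iH _ _] := iotaP r r0; have [j jH jK] := star_iso_inv iH.
    exists r, (fun b => rho (j b)); split => //.
      apply: (@irr_factor R (CG r) _ H (iota r)); first exact: rep_comp.
      by rewrite (_ : (fun a => _) = rho) //; apply/funext => a; rewrite jK.
    by apply/funext => a; apply/funext => v; rewrite piE jK.
  case=> [[r [rho [r0 rho_irr ->]]]|[w pi_nu]].
    have [[iH _] iU iV] := iotaP r r0; have [xiH xiI xiU] := xiP r.
    apply: (irr_comp (star_hom_comp xiH iH) (@rot_generates _ _ Atheta)) => //.
    (* The image of [CD] contains the generators [U], and [V] as [z / r]. *)
    move=> _ [->|->]; first by exists (cp_unit CD) => //; rewrite xiU iU.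
    have [xil _ _ _] := xiH; have [il _ _ _] := iH.
    have [z zP] := restrict_circle_surj (circle_coord r).
    exists ((r%:num)^-1%:C *: cp_incl CD z) => //.
    rewrite (linZ xil) (linZ il) xiI zP iV scalerA -rmorphM /=.
    by rewrite mulVf ?gt_eqF // scale1r.
  apply: (equivalent_irr pi_nu).
  have [xiH _ _] := xiP 0%:i01; have [[iH _] _] := iota0P.
  exact: irr_nu (star_hom_comp xiH iH).
move=> H K r s rho sigma rho_irr sigma_irr; split; last first.
  move=> [e]; case: _ / e sigma sigma_irr => /= sigma sigma_irr [W [WL Wb WU WE]].
  by exists W.
move=> [W [WL Wb WU WE]].
have [rhoP _ _] := rho_irr; have [sP _ _] := sigma_irr.
have rho1 := irr_unital rho_irr; have s1 := irr_unital sigma_irr.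
(* The function [|z|] acts on the circle of radius [t] as the scalar [t], so a
   unitary equivalence forces the radii to agree. *)
pose N : CX R (disk R) := mkCX (@disk_norm_continuous R).
have act (t : {i01 R}) (L : hilbertType R) (tau : CG t -> L -> L) v :
    representation tau -> (forall v, tau aone v = v) ->
    tau (xi t (cp_incl CD N)) v = (t%:num)%:C *: v.
  move=> tP t1; have [_ xiI _] := xiP t; have [il i1 _ _] := cp_incl_hom (CG t).
  rewrite xiI (_ : restrict_circle t N = (t%:num)%:C *: aone).
    by rewrite (linZ il) i1 (linZ (rep_lin tP v)) t1.
  apply: CXP => x; rewrite CXZE CX1E mulr1; congr (_%:C).
  by apply/circle_setE; exact: set_mem (valP x).
have e : r = s.
  have [x x0] := irr_exists_nonzero rho_irr.
  have := WE (cp_incl CD N) x; rewrite act // act // (linZ WL) => E.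
  apply/val_inj/(@complexI R)/eqP; rewrite -subr_eq0.
  have Wx0 : W x != 0.
    apply/eqP => Wx; apply: x0; apply: nrm0_eq.
    by rewrite -(isometry_nrm WU) Wx nrm0.
  have : ((r%:num)%:C - (s%:num)%:C) *: W x = 0 by rewrite scalerBl E subrr.
  by move/eqP; rewrite scaler_eq0 (negbTE Wx0) orbF.
exists e; case: _ / e sigma sigma_irr WE sP s1 => /= sigma sigma_irr WE sP s1.
exists W; split => //.
apply: (intertwiner_generates (@cp_generates _ _ _ (CG r)) rhoP sP) => //.
have [_ xiI xiU] := xiP r.
move=> _ [[f _ <-]|->] x; last by rewrite -xiU WE.
by have [g <-] := restrict_circle_surj f; rewrite -xiI WE.
Qed.
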